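(* Let $H$ be an infinite dimensional Hilbert space and let $T=[(T_\varepsilon)]:\mathcal{G}_H\to\mathcal{G}_H$ be a selfadjoint Hilbert-Schmidt operator, i.e. each $T_\varepsilon$ is a selfadjoint Hilbert-Schmidt operator on $H$. Let $T_0\in\mathrm{supp}(T)$ and let $e=e^2\in\overline{\mathbb{R}}$, $e\neq0$, be such that $e\cdot T\approx e\cdot T_0$. For each $\varepsilon$ let $(t_n(\varepsilon))_{n\in\mathbb{N}}$ be an enumeration of the eigenvalues of $T_\varepsilon$, let $t(\alpha)=(t_n(\alpha))_n$ denote the net of these sequences, and let $t_0=(t_1,t_2,\dots)$ be an enumeration of the eigenvalues of $T_0$. Then there exists a permutation net $\pi=(\pi_\varepsilon)\in[\mathrm{Sym}(\mathbb{N})]^{]0,1]}$ such that $$e\cdot\Bigg[\sum_{n=1}^\infty|t_n-t_{\pi_\alpha(n)}(\alpha)|^2\Bigg]^{1/2}\le\|e\cdot(T-T_0)\|+e\cdot\alpha\approx0 .$$ Moreover, $t(\alpha)\in l_2(\overline{\mathbb{R}})$ and $t^\pi_n\longrightarrow t_0$, where $t^\pi(\alpha)=(t^\pi_n)_n$ with $t^\pi_n=t_{\pi_\alpha(n)}(\alpha)$; that is, the net of rearranged eigenvalue sequences $t^\pi(\alpha)$ converges to the sequence $t_0$.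
   Context: Let $I=\,]0,1]$. For a normed space $E$, a net $(x_\varepsilon)\in E^I$ is moderate if there is $n\in\mathbb{Z}$ with $\|x_\varepsilon\|\le\varepsilon^n$ for all small $\varepsilon$, and null if for each $q\in\mathbb{N}$, $\|x_\varepsilon\|\le\varepsilon^q$ for all small $\varepsilon$; $\mathcal{G}_E$ denotes moderate nets modulo null nets, and $\overline{\mathbb{R}}=\mathcal{G}_{\mathbb{R}}$ is the ring of Colombeau generalized real numbers. $l_2(\overline{\mathbb{R}})$ denotes the generalized counterpart of the space $l_2(\mathbb{R})$ of square summable real sequences: its elements are sequences of generalized numbers represented by nets $\varepsilon\mapsto(x_n(\varepsilon))_n\in l_2(\mathbb{R})$ that are moderate in the $l_2$ norm. Every idempotent of $\overline{\mathbb{R}}$ is the class of the characteristic function of a set $S\subset I$. $\alpha=[\varepsilon\mapsto\varepsilon]$ is the natural gauge. Writing $\alpha$ as an argument or index stands for the net in $\varepsilon$: $t_{\pi_\alpha(n)}(\alpha)$ is the net $\varepsilon\mapsto t_{\pi_\varepsilon(n)}(\varepsilon)$. The order on $\overline{\mathbb{R}}$ is the one induced by representatives for small $\varepsilon$ (up to null nets); $x\approx y$ means that the norm of the difference of representatives tends to $0$ as $\varepsilon\to0$. The norm $\|\cdot\|$ on operators is the Hilbert-Schmidt norm, extended to nets by $\|T\|=[\|T_\varepsilon\|]$ (so the nets of operators considered are moderate in this norm). $T$ acts on $\mathcal{G}_H$ by $T[(x_\varepsilon)]=[(T_\varepsilon x_\varepsilon)]$. $T_0\in\mathrm{supp}(T)$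 means that $T_0$ is a bounded operator on $H$ for which there is an idempotent $e\neq0$ with $e\cdot T\approx e\cdot T_0$, i.e. $\|e_\varepsilon(T_\varepsilon-T_0)\|\to0$ as $\varepsilon\to 0$. Eigenvalues are enumerated with multiplicity. $\mathrm{Sym}(\mathbb{N})$ is the group of permutations of $\mathbb{N}$.
   Formalization: The final convergence of the rearranged eigenvalue sequences to t_0 is proved in l_2 norm only as ε→0 within S, for every S with e=[1_S]; unrestricted convergence fails in general, e.g. T_ε=T_0≠0 for ε in S={1/n} and T_ε=0 otherwise. *)

(* Defs.v *)
From HB Require Import structures.
From mathcomp Require Import all_boot all_order all_algebra.
From mathcomp Require Import sesquilinear ring_quotient.
From mathcomp Require Import complex.
From mathcomp Require Import all_classical all_reals all_analysis.

Set Implicit Arguments.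
Unset Strict Implicit.
Unset Printing Implicit Defensive.

Import Order.TTheory GRing.Theory Num.Theory.
Import numFieldNormedType.Exports.
Local Open Scope quotient_scope.

Local Open Scope classical_set_scope.
Local Open Scope ring_scope.

Definition I01 (R : realType) : Type := {eps : R | 0 < eps <= 1}.

Lemma I01_one_subproof (R : realType) : 0 < (1 : R) <= 1.
Proof. by rewrite ltr01 lexx. Qed.

HB.instance Definition _ (R : realType) := SubChoice.on (I01 R).
HB.instance Definition _ (R : realType) :=
  isPointed.Build (I01 R) (exist (fun e : R => is_true (0 < e <= 1)) 1 (I01_one_subproof R)).

(* "for all small eps", i.e. the filter eps -> 0 on ]0, 1] *)
Definition small (R : realType) : set_system (I01 R) :=
  [set A | exists2 d : R, 0 < d & forall eps : I01 R, val eps < d -> A eps].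

#[global] Instance small_filter (R : realType) : ProperFilter (@small R).
Proof.
apply: Build_ProperFilter_ex.
- move=> A [d d0 dA].
  have m0 : 0 < Num.min 1 (d / 2) by rewrite lt_min ltr01 divr_gt0.
  have m1 : 0 < Num.min 1 (d / 2) <= 1 by rewrite m0 ge_min lexx.
  exists (exist (fun e : R => is_true (0 < e <= 1)) _ m1); apply: dA => /=.
  by rewrite gt_min ltr_pdivrMr// mulr_natr mulr2n ltrDl d0 orbT.
- split.
  + by exists 1.
  + move=> A B [a a0 aA] [b b0 bB]; exists (Num.min a b).
      by rewrite lt_min a0 b0.
    by move=> eps; rewrite lt_min => /andP[ea eb]; split; [exact: aA|exact: bB].
  + by move=> A B AB [a a0 aA]; exists a => // eps /aA /AB.
Qed.

(* The definitions apply to extended real nets (such as nets of norms that are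
   possibly infinite); a moderate or null net is finite for all small eps. *)
Definition moderate (R : realType) (u : I01 R -> \bar R) : Prop :=
  exists n : int, \forall eps \near @small R, (`|u eps| <= (val eps ^ n)%:E)%E.

Definition null (R : realType) (u : I01 R -> \bar R) : Prop :=
  forall q : nat, \forall eps \near @small R,
    (`|u eps| <= (val eps ^+ q)%:E)%E.

Definition moderate_pred (R : realType) : {pred I01 R -> R} :=
  fun u => `[< moderate (EFin \o u) >].

Section GenNumConstruction.
Variable R : realType.
Implicit Types (u v : I01 R -> R) (eps : I01 R).

Lemma I01_gt0 eps : 0 < val eps.
Proof. by case/andP: (valP eps). Qed.

Lemma I01_le1 eps : val eps <= 1.
Proof. by case/andP: (valP eps). Qed.

Lemma small_lt (d : R) : 0 < d -> \forall eps \near @small R, val eps < d.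
Proof. by move=> d0; exists d. Qed.

Lemma moderateP u : moderate (EFin \o u) <->
  exists n : nat, \forall eps \near @small R, `|u eps| <= val eps ^- n.
Proof.
split=> [[n un]|[n un]]; last first.
  exists (- n%:Z); apply: filterS un => eps /=.
  by rewrite lee_fin exprnN.
exists `|n|%N; apply: filterS un => eps /=; rewrite lee_fin => /le_trans; apply.
case: n => n /=.
  rewrite -exprnP (@le_trans _ _ 1)//.
    by rewrite exprn_ile1// ?I01_le1// ltW// I01_gt0.
  by rewrite invf_ge1 ?exprn_gt0 ?I01_gt0// exprn_ile1// ?I01_le1// ltW// I01_gt0.
by [].
Qed.

Lemma nullP u : null (EFin \o u) <->
  forall q : nat, \forall eps \near @small R, `|u eps| <= val eps ^+ q.
Proof.
by split=> uq q; move: (uq q); apply: filterS => eps /=; rewrite lee_fin.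
Qed.

Lemma powV_le eps (m n : nat) : (m <= n)%N -> val eps ^- m <= val eps ^- n.
Proof.
move=> mn; rewrite lef_pV2 ?posrE ?exprn_gt0 ?I01_gt0//.
by rewrite ler_wiXn2l// ?I01_le1// ltW// I01_gt0.
Qed.

Lemma moderate_subring_closed : subring_closed (@moderate_pred R).
Proof.
split.
- apply/asboolP/moderateP; exists 0%N; apply: nearW => eps /=.
  by rewrite expr0 invr1 normr1.
- move=> u v /asboolP/moderateP[m um] /asboolP/moderateP[n vn].
  apply/asboolP/moderateP; exists (m + n).+1.
  have half : 0 < (2^-1 : R) by rewrite invr_gt0.
  near=> eps.
  have e0 := I01_gt0 eps.
  have eh : val eps < 2^-1 by near: eps; exact: small_lt.
  have uE : `|u eps| <= val eps ^- (m + n).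
    by apply: le_trans (powV_le _ (leq_addr _ _)); near: eps.
  have vE : `|v eps| <= val eps ^- (m + n).
    by apply: le_trans (powV_le _ (leq_addl _ _)); near: eps.
  apply: le_trans (ler_normB _ _) _; apply: le_trans (lerD uE vE) _.
  rewrite -mulr2n -mulr_natl exprS invfM ler_wpM2r//.
    by rewrite invr_ge0 exprn_ge0// ltW.
  by rewrite -[2%R]invrK lef_pV2 ?posrE// ltW.
- move=> u v /asboolP/moderateP[m um] /asboolP/moderateP[n vn].
  apply/asboolP/moderateP; exists (m + n)%N.
  near=> eps.
  rewrite normrM exprD invfM ler_pM//; by near: eps.
Unshelve. all: by end_near. Qed.

HB.instance Definition _ :=
  GRing.isSubringClosed.Build (I01 R -> R) (@moderate_pred R)
    moderate_subring_closed.

Record mnet := MNet { mnet_val :> I01 R -> R; _ : mnet_val \in @moderate_pred R }.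

HB.instance Definition _ := [isSub for mnet_val].
HB.instance Definition _ := [Choice of mnet by <:].
HB.instance Definition _ := [SubChoice_isSubComNzRing of mnet by <:].

Definition null_ideal : {pred mnet} := fun u : mnet => `[< null (EFin \o val u) >].

Lemma null_idealr_closed : idealr_closed null_ideal.
Proof.
split.
- apply/asboolP/nullP => q; apply: nearW => eps /=.
  by rewrite normr0 exprn_ge0// ltW// I01_gt0.
- apply/negP => /asboolP/nullP/(_ 1%N) one1.
  have half : 0 < (2^-1 : R) by rewrite invr_gt0.
  have [eps []] := @filter_ex _ _ (small_filter R) _
    (filterI one1 (small_lt half)).
  rewrite expr1 /= normr1 => e1 e2.
  by have := le_lt_trans e1 e2; rewrite invf_gt1// ltNge ler1n.
- move=> a u v /asboolP/nullP u0 /asboolP/nullP v0; apply/asboolP/nullP => q.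
  have /asboolP/moderateP[n an] := valP a.
  have half : 0 < (2^-1 : R) by rewrite invr_gt0.
  near=> eps.
  have e0 := I01_gt0 eps.
  have eh : val eps < 2^-1 by near: eps; exact: small_lt.
  have aE : `|val a eps| <= val eps ^- n by near: eps.
  have uE : `|val u eps| <= val eps ^+ (n + q.+1) by near: eps; exact: u0.
  have vE : `|val v eps| <= val eps ^+ q.+1 by near: eps; exact: v0.
  have auE : `|val a eps * val u eps| <= val eps ^+ q.+1.
    rewrite normrM; apply: le_trans (ler_pM _ _ aE uE) _ => //.
    by rewrite exprD mulKf// expf_neq0// gt_eqF.
  apply: le_trans (ler_normD _ _) _; apply: le_trans (lerD auE vE) _.
  rewrite -mulr2n -mulr_natl exprS mulrA ler_piMl ?exprn_ge0 ?ltW//.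
  by rewrite mulrC -ltr_pdivlMr// div1r.
Unshelve. all: by end_near. Qed.

HB.instance Definition _ := isIdealr.Build mnet null_ideal null_idealr_closed.

End GenNumConstruction.

Definition gennum (R : realType) : Type := {ideal_quot (@null_ideal R)}.
HB.instance Definition _ (R : realType) := GRing.ComNzRing.on (gennum R).
HB.instance Definition _ (R : realType) := EqQuotient.on (gennum R).

(* [gclass u x]: x is the class of the net u (in particular u is moderate). *)
Definition gclass (R : realType) (u : I01 R -> \bar R) (x : gennum R) : Prop :=
  exists v : mnet R, x = \pi_(gennum R) v /\
    \forall eps \near @small R, u eps = (v eps)%:E.

Definition grepr (R : realType) (x : gennum R) : I01 R -> R := repr x : mnet R.

Lemma alpha_subproof (R : realType) :
  (fun eps : I01 R => val eps) \in @moderate_pred R.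
Proof.
apply/asboolP/moderateP; exists 0%N; apply: nearW => eps.
by rewrite expr0 invr1 ger0_norm ?I01_le1// ltW// I01_gt0.
Qed.

Definition alpha (R : realType) : gennum R :=
  \pi_(gennum R) (MNet (alpha_subproof R)).

Definition gle (R : realType) (x y : gennum R) : Prop :=
  exists u v : mnet R, [/\ x = \pi_(gennum R) u, y = \pi_(gennum R) v &
    \forall eps \near @small R, u eps <= v eps].

Definition gapprox (R : realType) (x y : gennum R) : Prop :=
  grepr x eps - grepr y eps @[eps --> @small R] --> (0 : R).

Variant scalar_kind := RealScalars | ComplexScalars.

Definition scalar (R : realType) (k : scalar_kind) : numFieldType :=
  match k with
  | RealScalars => R
  | ComplexScalars => R[i]
  end.

Definition sconj (R : realType) (k : scalar_kind) :
    scalar R k -> scalar R k :=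
  match k return scalar R k -> scalar R k with
  | RealScalars => fun a => a
  | ComplexScalars => fun a => conjc a
  end.

Definition sre (R : realType) (k : scalar_kind) : scalar R k -> R :=
  match k return scalar R k -> R with
  | RealScalars => fun a => a
  | ComplexScalars => fun a => complex.Re a
  end.

Definition ofreal (R : realType) (k : scalar_kind) : R -> scalar R k :=
  match k return R -> scalar R k with
  | RealScalars => fun a => a
  | ComplexScalars => fun a => real_complex R a
  end.

Record hilbertSpace (R : realType) (k : scalar_kind) := HilbertSpace {
  hilbert_carrier :> completeNormedModType (scalar R k);
  inner : {dot hilbert_carrier for @sconj R k};
  inner_norm : forall x : hilbert_carrier, inner x x = `|x| ^+ 2 }.
Arguments inner {R k} h.

Section HilbertSpaces.
Variables (R : realType) (k : scalar_kind) (H : hilbertSpace R k).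
Implicit Types (A : H -> H).

(* The norm of a normed module takes its values in the scalar field. *)
Definition rnorm (x : H) : R := sre `|x|.

Definition lin_indep (m : nat) (v : 'I_m -> H) : Prop :=
  forall c : 'I_m -> scalar R k,
    \sum_(i < m) c i *: v i = 0 -> forall i, c i = 0.

Definition infinite_dimensional : Prop :=
  forall m : nat, exists v : 'I_m -> H, lin_indep v.

Definition orthonormal_basis (B : set H) : Prop :=
  (forall x y, B x -> B y -> inner H x y = (x == y)%:R) /\
  (forall x, (forall b, B b -> inner H x b = 0) -> x = 0).

Definition hilbert_basis : set H :=
  xget set0 [set B : set H | orthonormal_basis B].

(* The value does not depend on the choice of the orthonormal basis; it is +oo
   when A is not Hilbert-Schmidt. *)
Definition hs_norm A : \bar R :=
  sqrte (\esum_(b in hilbert_basis) (rnorm (A b) ^+ 2)%:E).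

Definition bounded_operator A : Prop :=
  exists M : scalar R k, forall x, `|A x| <= M * `|x|.

Definition hilbert_schmidt A : Prop :=
  bounded_operator A /\ (hs_norm A < +oo)%E.

Definition selfadjoint A : Prop :=
  forall x y, inner H (A x) y = inner H x (A y).

(* For every scalar lam, the number of indices n with t n = lam equals the
   dimension of the eigenspace ker (A - lam), as elements of nat + {infinity}:
   both numbers are at least m for the same m. In particular 0 is listed
   exactly dim (ker A) times, and all infinite dimensions are identified, so
   that nonseparable spaces are allowed. *)
Definition eigenvalue_enum A (t : nat -> R) : Prop :=
  forall (lam : scalar R k) (m : nat),
    (`I_m #<= [set n | ofreal k (t n) = lam])%card <->
    exists v : 'I_m -> H, lin_indep v /\ forall i, A (v i) = lam *: v i.

(* The net e (T - T0). Changing the representative of e changes its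
   Hilbert-Schmidt norm by a null net only, T and T0 being moderate. *)
Definition scaled_diff (e : gennum R) (T : I01 R -> {linear H -> H})
    (T0 : {linear H -> H}) (eps : I01 R) : H -> H :=
  fun x => ofreal k (grepr e eps) *: (T eps x - T0 x).

Definition op_approx (e : gennum R) (T : I01 R -> {linear H -> H})
    (T0 : {linear H -> H}) : Prop :=
  hs_norm (scaled_diff e T T0 eps) @[eps --> @small R] --> 0%E.

Definition supp (T : I01 R -> {linear H -> H}) (T0 : {linear H -> H}) : Prop :=
  bounded_operator T0 /\
  exists e : gennum R, [/\ e ^+ 2 = e, e != 0 & op_approx e T T0].

End HilbertSpaces.

Definition l2norm (R : realType) (u : nat -> R) : \bar R :=
  sqrte (\sum_(0 <= n <oo) (`|u n| ^+ 2)%:E).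

(* The net t represents an element of the generalized l_2. *)
Definition l2_moderate (R : realType) (t : I01 R -> nat -> R) : Prop :=
  (forall eps, (l2norm (t eps) < +oo)%E) /\
  moderate (fun eps => l2norm (t eps)).

(* Main.v *)
(** For selfadjoint Hilbert-Schmidt operators A and B with eigenvalues a and b
    and for d > 0, a permutation pi of the indices satisfies
    |a - b o pi|_2 <= |A - B| + d (the Hoffman-Wielandt inequality of Bhatia and
    Elsner). Indeed |A|^2 = sum a_n^2 by the spectral theorem, so A and B are
    close to their truncations to N eigenvectors u_i and v_j, and the squared
    distance of the truncations is
    sum a_i^2 + sum b_j^2 - 2 sum_ij a_i b_j |<u_i, v_j>|^2. The matrix
    |<u_i, v_j>|^2 is doubly substochastic, so the last sum is at most
    sum a_i b_(s i) for a permutation s of the 2 N indices of the sequences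
    padded with zeros; s extended by the identity is pi.

    For the corollary apply this to T0 and T_eps with d = eps, for every eps.
    The idempotent e is only used to see that T0, a limit of the T_eps along the
    support of e, is again selfadjoint and Hilbert-Schmidt. *)
Require Import Defs.
From HB Require Import structures.
From mathcomp Require Import all_boot all_order all_algebra.
From mathcomp Require Import perm.
From mathcomp Require Import sesquilinear ring_quotient.
From mathcomp Require Import complex.
From mathcomp Require Import all_classical all_reals all_analysis.
From mathcomp Require Import ring lra zify.

Import Order.TTheory GRing.Theory Num.Theory.
Import numFieldNormedType.Exports.

Local Open Scope classical_set_scope.
Local Open Scope ring_scope.

Set Implicit Arguments.
Unset Strict Implicit.
Unset Printing Implicit Defensive.

(** * Scalars *)

(** An enumeration only counts multiplicities: it supplies no eigenvectors, and it does not say that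
    they exhaust the operator. The spectral theorem is therefore proved in the following form.
    Orthonormal eigenvectors u_n can be chosen along the enumeration, and A vanishes on their
    orthogonal complement, because a nonzero eigenvalue occurring there would have been listed too
    few times. The u_n need not span H, whose kernel part may be uncountable; what counts is that A
    maps into their closed span. Eigenvectors come from power iteration. The even iterates of a
    selfadjoint contraction converge, and the square summability of |A b| over a basis takes the
    place of compactness in showing that the limit is not always zero. The two truncations live on
    different subspaces. They are compared on one finite orthonormal family that contains the u_i
    and spans the v_j: for a selfadjoint operator the sum of |A e|^2 over any such family is at most
    |A|^2, so independence of the basis is never invoked. *)

Section ScalarTheory.
Variables (R : realType) (k : scalar_kind).
Implicit Types (r s : R) (a b : Defs.scalar R k).

Lemma sconj_zmod : zmod_morphism (@sconj R k).
Proof. by case: k => //= a b; rewrite rmorphB. Qed.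

Lemma sconj_monoid : monoid_morphism (@sconj R k).
Proof. by case: k => //=; split=> [|a b]; rewrite ?rmorph1 ?rmorphM. Qed.

HB.instance Definition _ := GRing.isZmodMorphism.Build
  (Defs.scalar R k) (Defs.scalar R k) (@sconj R k) sconj_zmod.
HB.instance Definition _ := GRing.isMonoidMorphism.Build
  (Defs.scalar R k) (Defs.scalar R k) (@sconj R k) sconj_monoid.

Lemma ofreal_zmod : zmod_morphism (@ofreal R k).
Proof. by case: k => //= a b; rewrite rmorphB. Qed.

Lemma ofreal_monoid : monoid_morphism (@ofreal R k).
Proof. by case: k => //=; split=> [|a b]; rewrite ?rmorph1 ?rmorphM. Qed.

HB.instance Definition _ := GRing.isZmodMorphism.Build
  R (Defs.scalar R k) (@ofreal R k) ofreal_zmod.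
HB.instance Definition _ := GRing.isMonoidMorphism.Build
  R (Defs.scalar R k) (@ofreal R k) ofreal_monoid.

Lemma sre_zmod : zmod_morphism (@sre R k).
Proof. by case: k => //= a b; rewrite raddfB. Qed.

HB.instance Definition _ := GRing.isZmodMorphism.Build
  (Defs.scalar R k) R (@sre R k) sre_zmod.

Lemma sreK r : sre (ofreal k r) = r.
Proof. by case: k. Qed.

Lemma sreZ r a : sre (ofreal k r * a) = r * sre a.
Proof. by case: k a => //= -[x y] /=; rewrite mul0r subr0. Qed.

Lemma ler_ofreal r s : (ofreal k r <= ofreal k s) = (r <= s).
Proof. by case: k => //=; rewrite lecR. Qed.

Lemma ltr_ofreal r s : (ofreal k r < ofreal k s) = (r < s).
Proof. by case: k => //=; rewrite ltcR. Qed.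

Lemma sconj_ofreal r : sconj (ofreal k r) = ofreal k r.
Proof. by case: k => //=; exact: conjc_real. Qed.

Lemma sre_sconj a : sre (sconj a) = sre a.
Proof. by case: k a => //= -[]. Qed.

Lemma ofreal_norm a : ofreal k (sre `|a|) = `|a|.
Proof. by case: k a => //= a; rewrite normc_def. Qed.

Lemma ofreal_inj : injective (@ofreal R k).
Proof. by move=> r s /(congr1 (@sre R k)); rewrite !sreK. Qed.

Definition sabs a : R := sre `|a|.

Lemma sabs_ge0 a : 0 <= sabs a.
Proof. by rewrite -ler_ofreal ofreal_norm rmorph0. Qed.

Lemma sabs_ofreal r : sabs (ofreal k r) = `|r|.
Proof.
rewrite /sabs; case: k => //.
apply: (etrans (congr1 (@complex.Re R) (normc_def (real_complex R r)))) => /=.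
by rewrite expr0n addr0 sqrtr_sqr.
Qed.

Lemma sabsM a b : sabs (a * b) = sabs a * sabs b.
Proof. by apply: ofreal_inj; rewrite rmorphM /= !ofreal_norm normrM. Qed.

Lemma sabs_conj a : sabs (sconj a) = sabs a.
Proof.
by rewrite /sabs; case: k a => // a; exact: (congr1 (@complex.Re R) (normcJ a)).
Qed.

Lemma sabs0 : sabs 0 = 0.
Proof. by rewrite /sabs normr0 raddf0. Qed.

Lemma sabs_eq0 a : (sabs a == 0) = (a == 0).
Proof.
by rewrite -[RHS]normr_eq0 -ofreal_norm fmorph_eq0.
Qed.

Lemma mul_sconj a : a * sconj a = ofreal k (sabs a ^+ 2).
Proof.
rewrite rmorphXn /= ofreal_norm; case: k a => /= a; last exact/esym/sqr_normc.
by rewrite -normrX ger0_norm ?sqr_ge0.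
Qed.

Lemma sre_le_sabs a : sre a <= sabs a.
Proof.
rewrite /sabs; case: k a => a; first exact: ler_norm.
have := normc_ge_Re a; rewrite lecE => /andP[_]; apply: le_trans => /=.
exact: ler_norm.
Qed.

End ScalarTheory.

(** * Orthonormal families *)

Section InnerProduct.
Variables (R : realType) (k : scalar_kind) (H : hilbertSpace R k).
Implicit Types (x y z : H) (a : Defs.scalar R k) (r : R).
Local Notation ip := (inner H).

Lemma ipC x y : ip x y = sconj (ip y x).
Proof. by rewrite hermC /= mul1r. Qed.

Lemma ipDl x y z : ip (x + y) z = ip x z + ip y z.
Proof. exact: linearDl. Qed.

Lemma ipDr x y z : ip z (x + y) = ip z x + ip z y.
Proof. exact: linearDr. Qed.

Lemma ipBl x y z : ip (x - y) z = ip x z - ip y z.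
Proof. exact: linearBl. Qed.

Lemma ipBr x y z : ip z (x - y) = ip z x - ip z y.
Proof. exact: linearBr. Qed.

Lemma ipZl a x y : ip (a *: x) y = a * ip x y.
Proof. exact: linearZl_LR. Qed.

Lemma ipZr a x y : ip x (a *: y) = sconj a * ip x y.
Proof. exact: linearZr_LR. Qed.

Lemma ip0l x : ip 0 x = 0.
Proof. exact: linear0l. Qed.

Lemma ip0r x : ip x 0 = 0.
Proof. exact: linear0r. Qed.

Lemma ip_suml (I : Type) (s : seq I) (P : pred I) (E : I -> H) y :
  ip (\sum_(i <- s | P i) E i) y = \sum_(i <- s | P i) ip (E i) y.
Proof. exact: linear_sumlz. Qed.

Lemma ip_sumr (I : Type) (s : seq I) (P : pred I) (E : I -> H) y :
  ip y (\sum_(i <- s | P i) E i) = \sum_(i <- s | P i) ip y (E i).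
Proof. exact: linear_sumr. Qed.

Lemma ofreal_rnorm x : ofreal k (rnorm x) = `|x|.
Proof. by rewrite /rnorm -[in RHS]normr_id -ofreal_norm normr_id. Qed.

Lemma rnorm_ge0 x : 0 <= rnorm x.
Proof. by rewrite -(@ler_ofreal _ k) ofreal_rnorm rmorph0. Qed.

Lemma rnorm0 : rnorm (0 : H) = 0.
Proof. by rewrite /rnorm normr0 raddf0. Qed.

Lemma rnorm_eq0 x : (rnorm x == 0) = (x == 0).
Proof. by rewrite -[RHS]normr_eq0 -ofreal_rnorm fmorph_eq0. Qed.

Lemma rnormN x : rnorm (- x) = rnorm x.
Proof. by rewrite /rnorm normrN. Qed.

Lemma rnorm_distC x y : rnorm (x - y) = rnorm (y - x).
Proof. by rewrite /rnorm distrC. Qed.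

Lemma rnormZ a x : rnorm (a *: x) = sabs a * rnorm x.
Proof.
apply: (@ofreal_inj _ k).
by rewrite rmorphM /= !ofreal_rnorm ofreal_norm normrZ.
Qed.

Lemma ler_rnormD x y : rnorm (x + y) <= rnorm x + rnorm y.
Proof.
by rewrite -(@ler_ofreal _ k) rmorphD /= !ofreal_rnorm ler_normD.
Qed.

Lemma ipxx x : ip x x = ofreal k (rnorm x ^+ 2).
Proof. by rewrite inner_norm rmorphXn /= ofreal_rnorm. Qed.

Lemma normalizedP x : x != 0 ->
  ip (ofreal k (rnorm x)^-1 *: x) (ofreal k (rnorm x)^-1 *: x) = 1.
Proof.
move=> x0; have nx : rnorm x != 0 by rewrite rnorm_eq0.
by rewrite ipZl ipZr ipxx sconj_ofreal -!rmorphM /= expr2 mulKf// mulVf// rmorph1.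
Qed.

Definition rip x y : R := sre (ip x y).
Definition sqip x y : R := sabs (ip x y) ^+ 2.

Lemma ripC x y : rip x y = rip y x.
Proof. by rewrite /rip ipC sre_sconj. Qed.

Lemma ripxx x : rip x x = rnorm x ^+ 2.
Proof. by rewrite /rip ipxx sreK. Qed.

Lemma sqipC x y : sqip x y = sqip y x.
Proof. by rewrite /sqip ipC sabs_conj. Qed.

Lemma sqip_ge0 x y : 0 <= sqip x y.
Proof. exact: sqr_ge0. Qed.

Lemma sqipZr a x y : sqip x (a *: y) = sabs a ^+ 2 * sqip x y.
Proof. by rewrite /sqip ipZr sabsM sabs_conj exprMn. Qed.

Lemma rnormD2 x y : rnorm (x + y) ^+ 2 = rnorm x ^+ 2 + 2 * rip x y + rnorm y ^+ 2.
Proof.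
rewrite -!ripxx /rip ipDl !ipDr !raddfD /= -!/(rip _ _) (ripC y x); ring.
Qed.

Lemma rnormB2 x y : rnorm (x - y) ^+ 2 = rnorm x ^+ 2 - 2 * rip x y + rnorm y ^+ 2.
Proof.
rewrite -!ripxx /rip ipBl !ipBr !raddfB /= -!/(rip _ _) (ripC y x); ring.
Qed.

(** One notion for sequences ([D = setT]) and for finite lists or bases ([f = id] on a set of
    vectors); [D] may be uncountable. *)
Definition orthonormal_on (I : eqType) (D : set I) (f : I -> H) : Prop :=
  forall i j, D i -> D j -> ip (f i) (f j) = (i == j)%:R.

Definition fourier (I : Type) (f : I -> H) (s : seq I) x : H :=
  \sum_(i <- s) ip x (f i) *: f i.

Section OrthonormalFamily.
Variables (I : eqType) (D : set I) (f : I -> H).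
Hypothesis fD : orthonormal_on D f.
Variable s : seq I.
Hypotheses (us : uniq s) (sD : forall i, i \in s -> D i).

Lemma rnorm_orthonormal i : D i -> rnorm (f i) = 1.
Proof.
move=> Di; have := fD Di Di.
rewrite ipxx eqxx -(rmorph1 (@ofreal R k)) => /ofreal_inj/eqP.
by rewrite sqrf_eq1 => /orP[/eqP//|/eqP N1]; have := rnorm_ge0 (f i); rewrite N1 ler0N1.
Qed.

Lemma ip_comb_in (c : I -> Defs.scalar R k) j : j \in s ->
  ip (\sum_(i <- s) c i *: f i) (f j) = c j.
Proof.
move=> js; rewrite ip_suml (bigD1_seq j)//= ipZl (fD (sD js) (sD js)) eqxx mulr1.
rewrite big1_seq ?addr0// => i /andP[ij iS].
by rewrite ipZl (fD (sD iS) (sD js)) (negPf ij) mulr0.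
Qed.

Lemma ip_comb_notin (c : I -> Defs.scalar R k) j : D j -> j \notin s ->
  ip (\sum_(i <- s) c i *: f i) (f j) = 0.
Proof.
move=> Dj js; rewrite ip_suml big1_seq// => i /andP[_ iS].
rewrite ipZl (fD (sD iS) Dj); case: eqP => [ij|_]; last by rewrite mulr0.
by rewrite -ij iS in js.
Qed.

Lemma rnorm_comb (c : I -> Defs.scalar R k) :
  rnorm (\sum_(i <- s) c i *: f i) ^+ 2 = \sum_(i <- s) sabs (c i) ^+ 2.
Proof.
rewrite -ripxx /rip ip_sumr raddf_sum /= !big_seq; apply: eq_bigr => j js.
by rewrite ipZr -big_seq ip_comb_in// mulrC mul_sconj sreK.
Qed.

Lemma rip_comb (c : I -> Defs.scalar R k) x :
  rip x (\sum_(i <- s) c i *: f i) = \sum_(i <- s) sre (sconj (c i) * ip x (f i)).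
Proof.
by rewrite /rip ip_sumr raddf_sum /=; apply: eq_bigr => i _; rewrite ipZr.
Qed.

Lemma rip_fourier x : rip x (fourier f s x) = \sum_(i <- s) sqip x (f i).
Proof.
rewrite rip_comb; apply: eq_bigr => i _.
by rewrite mulrC mul_sconj sreK.
Qed.

Lemma rnorm_fourier x : rnorm (fourier f s x) ^+ 2 = \sum_(i <- s) sqip x (f i).
Proof. by rewrite rnorm_comb. Qed.

Lemma rnorm_sub_fourier x :
  rnorm (x - fourier f s x) ^+ 2 = rnorm x ^+ 2 - \sum_(i <- s) sqip x (f i).
Proof. rewrite rnormB2 rip_fourier rnorm_fourier; ring. Qed.

Lemma bessel x : \sum_(i <- s) sqip x (f i) <= rnorm x ^+ 2.
Proof. by rewrite -subr_ge0 -rnorm_sub_fourier sqr_ge0. Qed.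

Lemma ip_sub_fourier x j : j \in s -> ip (x - fourier f s x) (f j) = 0.
Proof. by move=> js; rewrite ipBl ip_comb_in// subrr. Qed.

Lemma ip_sub_fourier_notin x j : D j -> j \notin s ->
  ip (x - fourier f s x) (f j) = ip x (f j).
Proof. by move=> Dj js; rewrite ipBl ip_comb_notin// subr0. Qed.

End OrthonormalFamily.

(** Bessel's inequality for the single unit vector [y / |y|]. *)
Lemma cauchy_schwarz x y : sqip x y <= rnorm x ^+ 2 * rnorm y ^+ 2.
Proof.
have [->|y0] := eqVneq y 0.
  by rewrite /sqip ip0r sabs0 expr0n rnorm0 expr0n mulr0.
have ny : 0 < rnorm y by rewrite lt_def rnorm_eq0 y0 rnorm_ge0.
have fD : orthonormal_on [set tt] (fun _ => ofreal k (rnorm y)^-1 *: y).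
  by move=> [] [] _ _; rewrite normalizedP.
have := @bessel _ _ _ fD [:: tt] isT (fun i _ => (match i with tt => erefl end)) x.
rewrite big_seq1 sqipZr sabs_ofreal ger0_norm ?invr_ge0 ?rnorm_ge0//.
by rewrite exprVn ler_pdivrMl ?exprn_gt0// mulrC.
Qed.

Lemma sabs_ip_le x y : sabs (ip x y) <= rnorm x * rnorm y.
Proof.
rewrite -(@ler_pXn2r _ 2) ?nnegrE ?sabs_ge0 ?mulr_ge0 ?rnorm_ge0//.
by rewrite exprMn cauchy_schwarz.
Qed.

Lemma rip_le x y : rip x y <= rnorm x * rnorm y.
Proof. exact: le_trans (sre_le_sabs _) (sabs_ip_le _ _). Qed.

End InnerProduct.

(** * Completeness and orthonormal bases *)

Section EsumReal.
Variables (R : realType) (I : choiceType) (D : set I) (a : I -> R).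

Lemma sum_le_esum (s : seq I) : (forall i, D i -> 0 <= a i) ->
  uniq s -> (forall i, i \in s -> D i) ->
  ((\sum_(i <- s) a i)%:E <= \esum_(i in D) (a i)%:E)%E.
Proof.
move=> a0 us sD; apply: esum_ge; exists [set` s].
  by split; [exact: finite_seq|move=> i /= /sD].
by rewrite -fsbig_seq// sumEFin.
Qed.

Lemma esum_le (M : \bar R) :
  (forall s, uniq s -> (forall i, i \in s -> D i) ->
    ((\sum_(i <- s) a i)%:E <= M)%E) ->
  (\esum_(i in D) (a i)%:E <= M)%E.
Proof.
move=> h; apply: ge_ereal_sup => _ [A [finA AD] <-].
have /finite_seqP[s sA] := finA.
have -> : A = [set` undup s].
  by rewrite sA; apply/seteqP; split => i /=; rewrite mem_undup.
rewrite -fsbig_seq ?undup_uniq// sumEFin; apply: h; first exact: undup_uniq.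
by move=> i; rewrite mem_undup => si; apply: AD; rewrite sA.
Qed.

End EsumReal.

Section Completeness.
Variables (R : realType) (k : scalar_kind) (H : hilbertSpace R k).
Implicit Types (x y z : H).
Local Notation ip := (inner H).

Lemma ler0_small (r : R) : (forall d, 0 < d -> r <= d) -> r <= 0.
Proof. by move=> h; apply/ler_addgt0Pl => d d0; rewrite addr0 h. Qed.

Lemma sabsD (a b : Defs.scalar R k) : sabs (a + b) <= sabs a + sabs b.
Proof.
by rewrite -(@ler_ofreal _ k) rmorphD /= !ofreal_norm ler_normD.
Qed.

(** A positive scalar is real, even in [R[i]], so the completeness of the normed module, stated with
    scalar radii, passes to real bounds. *)
Lemma rnorm_complete (x : nat -> H) :
  (forall d : R, 0 < d ->
    exists N, forall m n, (N <= m)%N -> (N <= n)%N -> rnorm (x m - x n) <= d) ->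
  exists y, forall d : R, 0 < d ->
    exists N, forall n, (N <= n)%N -> rnorm (x n - y) <= d.
Proof.
move=> xC.
have real_pos (e : Defs.scalar R k) : 0 < e -> exists2 d, 0 < d & e = ofreal k d.
  move=> e0; exists (sre `|e|); last by rewrite ofreal_norm gtr0_norm.
  by rewrite -(@ltr_ofreal _ k) ofreal_norm rmorph0 gtr0_norm.
have /cauchy_cvg xcvg : cauchy (x @ \oo).
  apply: cauchy_exP => e /real_pos[d d0 ->].
  have [N xN] := xC _ (divr_gt0 d0 (ltr0Sn R 1)).
  exists (x N); exists N => // n /= Nn.
  rewrite -ball_normE /= -ofreal_rnorm ltr_ofreal.
  by apply: le_lt_trans (xN _ _ _ _) _ => //; rewrite ltr_pdivrMr// mulr_natr mulr2n ltrDl.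
exists (lim (x @ \oo)) => d d0.
have := (cvgrPdist_le _ _).1 xcvg (ofreal k d).
rewrite -(rmorph0 (ofreal k)) ltr_ofreal => /(_ _ d0)[N _ xN].
exists N => n /xN /=.
by rewrite -ofreal_rnorm ler_ofreal rnorm_distC.
Qed.

Section Projection.
Variables (I : choiceType) (D : set I) (f : I -> H).
Hypothesis fD : orthonormal_on D f.

(** Pythagoras: the Fourier sum of [x] over [s] is the Fourier sum over [s] of the one over [t]. *)
Lemma rnorm_fourier_sub (s t : seq I) x : uniq s -> uniq t ->
  {subset s <= t} -> (forall i, i \in t -> D i) ->
  rnorm (fourier f t x - fourier f s x) ^+ 2 =
  \sum_(i <- t) sqip x (f i) - \sum_(i <- s) sqip x (f i).
Proof.
move=> us ut st tD.
have sD i : i \in s -> D i by move=> /st/tD.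
have coef i : i \in s -> ip (fourier f t x) (f i) = ip x (f i).
  by move=> /st it; rewrite (ip_comb_in fD).
have -> : fourier f s x = fourier f s (fourier f t x).
  rewrite {1 2}/fourier big_seq [RHS]big_seq.
  by apply: eq_bigr => i /coef ->.
rewrite (rnorm_sub_fourier fD)// (rnorm_fourier fD)//; congr (_ - _).
by rewrite !big_seq; apply: eq_bigr => i si; rewrite /sqip coef.
Qed.

(** As [D] may be uncountable, the projection is a limit of Fourier sums over finite sets [s n]
    whose Bessel sums are within the square of [1 / (n + 1)] of their supremum. Enlarging [s n] then
    moves the Fourier sum by at most [1 / (n + 1)]. *)
Lemma projection_exists x : exists y,
  (forall i, D i -> ip (x - y) (f i) = 0) /\
  (forall d : R, 0 < d -> exists s, [/\ uniq s, (forall i, i \in s -> D i) &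
    rnorm (y - fourier f s x) <= d]).
Proof.
pose E := [set r : R | exists s : seq I, [/\ uniq s, (forall i, i \in s -> D i) &
  r = \sum_(i <- s) sqip x (f i)]].
have E0 : E 0 by exists [::]; split => //; rewrite big_nil.
have Eub : ubound E (rnorm x ^+ 2) by move=> _ [s [us sD ->]]; exact: (bessel fD).
have Esup : has_sup E by split; [exists 0|exists (rnorm x ^+ 2)].
have Ele s : uniq s -> (forall i, i \in s -> D i) ->
    \sum_(i <- s) sqip x (f i) <= sup E.
  by move=> us sD; apply: ub_le_sup; [exact: Esup.2|exists s].
have /choice[s sP] n : exists s : seq I, [/\ uniq s, (forall i, i \in s -> D i) &
    sup E - \sum_(i <- s) sqip x (f i) <= (n.+1%:R^-1) ^+ 2].
  have n0 : 0 < (n.+1%:R^-1 : R) ^+ 2 by rewrite exprn_gt0// invr_gt0.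
  have [_ [s [us sD ->]]] := sup_adherent n0 Esup.
  by move=> lt; exists s; split => //; rewrite lerBlDr -lerBlDl ltW.
have near_fourier n t : uniq t -> (forall i, i \in t -> D i) -> {subset s n <= t} ->
    rnorm (fourier f t x - fourier f (s n) x) <= n.+1%:R^-1.
  move=> ut tD st; have [us sD sE] := sP n.
  rewrite -(@ler_pXn2r _ 2) ?nnegrE ?rnorm_ge0 ?invr_ge0 ?ler0n//.
  by rewrite rnorm_fourier_sub//; apply: le_trans sE; rewrite lerD2r Ele.
have inv_small d : 0 < d -> exists N, forall n, (N <= n)%N -> (n.+1%:R^-1 : R) <= d.
  move=> d0; exists (Num.truncn d^-1) => n Nn.
  rewrite invf_ple ?posrE//; apply: ltW.
  apply: lt_le_trans (truncnS_gt _) _; by rewrite ler_nat ltnS.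
have [|y yP] := @rnorm_complete (fun n => fourier f (s n) x).
  move=> d d0; have [N NP] := inv_small _ (divr_gt0 d0 (ltr0Sn R 1)).
  exists N => m n Nm Nn; pose t := undup (s m ++ s n).
  have tD i : i \in t -> D i.
    rewrite mem_undup mem_cat => /orP[]; [have [_ + _] := sP m|have [_ + _] := sP n].
      exact.
    exact.
  have -> : fourier f (s m) x - fourier f (s n) x =
     - (fourier f t x - fourier f (s m) x) + (fourier f t x - fourier f (s n) x).
    by rewrite opprB addrA subrK.
  apply: le_trans (ler_rnormD _ _) _; rewrite rnormN.
  have -> : d = d / 2 + d / 2 by rewrite -splitr.
  apply: lerD; [apply: le_trans (NP _ Nm)|apply: le_trans (NP _ Nn)];
    apply: near_fourier => //; rewrite ?undup_uniq// => i;
    by rewrite mem_undup mem_cat => ->; rewrite ?orbT.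
exists y; split; last first.
  move=> d d0; have [N NP] := yP _ d0; have [us sD _] := sP N.
  by exists (s N); split => //; rewrite rnorm_distC NP.
move=> j Dj; apply/eqP; rewrite -sabs_eq0 eq_le sabs_ge0 andbT.
apply: ler0_small => d d0.
have [N1 N1P] := yP _ (divr_gt0 d0 (ltr0Sn R 1)).
have [N2 N2P] := inv_small _ (divr_gt0 d0 (ltr0Sn R 1)).
pose n := maxn N1 N2; have [us sD sE] := sP n.
have -> : x - y = (x - fourier f (s n) x) + (fourier f (s n) x - y).
  by rewrite addrA subrK.
rewrite ipDl; apply: le_trans (sabsD _ _) _.
have -> : d = d / 2 + d / 2 by rewrite -splitr.
apply: lerD; last first.
  apply: le_trans (sabs_ip_le _ _) _; rewrite (rnorm_orthonormal fD)// mulr1.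
  by rewrite N1P ?leq_maxl.
apply: (@le_trans _ _ (n.+1%:R^-1)); last by rewrite N2P ?leq_maxr.
have [js|js] := boolP (j \in s n).
  by rewrite (ip_sub_fourier fD)// sabs0 invr_ge0 ler0n.
rewrite (ip_sub_fourier_notin fD)//.
rewrite -(@ler_pXn2r _ 2) ?nnegrE ?sabs_ge0 ?invr_ge0 ?ler0n//.
apply: le_trans sE; rewrite lerBrDr.
(* Adding [j] to [s n] raises the Bessel sum by [|<x, f j>|^2], which must fit into the gap below
   the supremum. *)
have := Ele (j :: s n); rewrite big_cons; apply => /=; first by rewrite js.
by move=> i; rewrite inE => /orP[/eqP->//|/sD].
Qed.

(* The orthogonal complement is not assumed to be trivial: x only has to lie in
   the closed span of the family. *)
Lemma parseval_le x :
  (forall y, (forall i, D i -> ip y (f i) = 0) -> ip x y = 0) ->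
  ((rnorm x ^+ 2)%:E <= \esum_(i in D) (sqip x (f i))%:E)%E.
Proof.
move=> xperp; have [y [yperp yapp]] := projection_exists x.
(* The vector [x - y] is orthogonal to the family, hence to [x], so
   [|x|^2 = Re <x, y> <= |x| |y|]. *)
have xy : rnorm x <= rnorm y.
  have [->|x0] := eqVneq x 0; first by rewrite rnorm0 rnorm_ge0.
  have x0' : 0 < rnorm x by rewrite lt_def rnorm_eq0 x0 rnorm_ge0.
  rewrite -(ler_pM2l x0') -expr2 -ripxx.
  have := congr1 (@sre R k) (xperp _ yperp); rewrite ipBr raddfB raddf0 /= => /eqP.
  by rewrite subr_eq0 -/(rip x x) => /eqP ->; exact: rip_le.
apply/lee_addgt0Pr => d d0.
(* Squaring [|x| <= r + e] costs at most [2 |x| e]; the added 1 keeps the denominator positive. *)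
pose e := d / (2 * rnorm x + 1).
have den : 0 < 2 * rnorm x + 1 by rewrite ltr_wpDl// mulr_ge0// rnorm_ge0.
have e0 : 0 < e by rewrite divr_gt0.
have [s [us sD sE]] := yapp _ e0.
apply: (@le_trans _ _ ((\sum_(i <- s) sqip x (f i))%:E + d%:E)%E); last first.
  by rewrite leeD2r//; apply: sum_le_esum => // i _; exact: sqip_ge0.
rewrite -EFinD lee_fin -(rnorm_fourier fD)//.
set r := rnorm (fourier f s x).
have xr : rnorm x <= r + e.
  apply: (le_trans xy); rewrite -[y](subrK (fourier f s x)).
  by apply: le_trans (ler_rnormD _ _) _; rewrite addrC lerD2l.
have ed : e * (2 * rnorm x + 1) <= d by rewrite divfK// gt_eqF.
have key (a b c : R) : 0 <= a -> 0 <= b -> 0 <= c -> a <= b + c ->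
    c * (2 * a + 1) <= d -> a ^+ 2 <= b ^+ 2 + d.
  move=> a0 b0 c0 abc cd.
  have [ac|ca] := leP a c.
    have : a * a <= c * a by rewrite ler_wpM2r.
    by have := sqr_ge0 b; have := mulr_ge0 c0 a0; rewrite expr2; lra.
  have : (a - c) ^+ 2 <= b ^+ 2.
    by rewrite ler_pXn2r// ?nnegrE ?subr_ge0 ?(ltW ca)// lerBlDr.
  by have := sqr_ge0 c; rewrite sqrrB; lra.
by apply: (key _ _ e) => //; [exact: rnorm_ge0|exact: rnorm_ge0|exact: ltW].
Qed.

Lemma bessel_esum x :
  (\esum_(i in D) (sqip x (f i))%:E <= (rnorm x ^+ 2)%:E)%E.
Proof. by apply: esum_le => s us sD; rewrite lee_fin (bessel fD). Qed.

Lemma parseval x :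
  (forall y, (forall i, D i -> ip y (f i) = 0) -> ip x y = 0) ->
  (rnorm x ^+ 2)%:E = \esum_(i in D) (sqip x (f i))%:E.
Proof. by move=> h; apply/eqP; rewrite eq_le parseval_le//= bessel_esum. Qed.

End Projection.

(** Zorn's lemma: a nonzero vector orthogonal to a maximal orthonormal set could be normalized and
    added. Hence the choice by [xget] in [hilbert_basis] never falls back to the empty default set
    without it being a basis. *)
Lemma orthonormal_basis_exists : exists B : set H, orthonormal_basis B.
Proof.
pose P := [set B : set H | forall x y, B x -> B y -> ip x y = (x == y)%:R].
have [|B [PB Bmax]] := @Zorn_bigcup H P.
  move=> F FP Ftot x y [X FX Xx] [Y FY Yy].
  have [XY|YX] := Ftot _ _ FX FY; first by apply: (FP _ FY) => //; exact: XY.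
  by apply: (FP _ FX) => //; exact: YX.
exists B; split => // x xB; apply/eqP/negPn/negP => x0.
pose y := ofreal k (rnorm x)^-1 *: x.
have yy : ip y y = 1 by exact: normalizedP.
have yB b : B b -> ip y b = 0 by move=> Bb; rewrite ipZl xB// mulr0.
have By b : B b -> ip b y = 0 by move=> Bb; rewrite ipC yB// rmorph0.
have nBy : ~ B y.
  by move=> /yB; rewrite yy => /eqP; rewrite oner_eq0.
apply: (Bmax (y |` B)).
  split; first by right.
  by move=> sub; apply: nBy; apply: sub; left.
move=> a b [->|Ba] [->|Bb].
- by rewrite yy eqxx.
- by rewrite yB//; case: eqP => // yb; rewrite yb in nBy.
- by rewrite By//; case: eqP => // yb; rewrite -yb in nBy.
- exact: PB.
Qed.

Lemma hilbert_basisP : orthonormal_basis (hilbert_basis (H := H)).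
Proof. by have [B BP] := orthonormal_basis_exists; exact: (xgetI set0 BP). Qed.

Lemma hilbert_basis_orthonormal : orthonormal_on (hilbert_basis (H := H)) id.
Proof. by move=> x y; exact: hilbert_basisP.1. Qed.

Lemma parseval_basis x :
  (rnorm x ^+ 2)%:E = \esum_(b in hilbert_basis (H := H)) (sqip x b)%:E.
Proof.
apply: (parseval hilbert_basis_orthonormal) => y yB.
by rewrite (hilbert_basisP.2 y yB) ip0r.
Qed.

End Completeness.

(** * Hilbert-Schmidt operators *)

Section FiniteSums.
Variables (R : rcfType) (I : Type).
Implicit Types (s : seq I) (u v : I -> R).

Definition l2s s u : R := Num.sqrt (\sum_(i <- s) u i ^+ 2).

Lemma l2s_ge0 s u : 0 <= l2s s u.
Proof. exact: sqrtr_ge0. Qed.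

Lemma sqr_l2s s u : l2s s u ^+ 2 = \sum_(i <- s) u i ^+ 2.
Proof. by rewrite sqr_sqrtr// sumr_ge0// => i _; exact: sqr_ge0. Qed.

Lemma cauchy_schwarz_sum s u v : \sum_(i <- s) u i * v i <= l2s s u * l2s s v.
Proof.
elim: s => [|i s IHs]; first by rewrite big_nil mulr_ge0 ?l2s_ge0.
rewrite big_cons; set p := l2s s u in IHs *; set q := l2s s v in IHs *.
apply: (@le_trans _ _ (u i * v i + p * q)); first by rewrite lerD2l.
have pP : l2s (i :: s) u ^+ 2 = u i ^+ 2 + p ^+ 2 by rewrite !sqr_l2s big_cons.
have qP : l2s (i :: s) v ^+ 2 = v i ^+ 2 + q ^+ 2 by rewrite !sqr_l2s big_cons.
apply: le_trans (ler_norm _) _.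
rewrite -(@ler_pXn2r _ 2) ?nnegrE ?normr_ge0 ?mulr_ge0 ?l2s_ge0//.
rewrite real_normK ?num_real// exprMn pP qP.
(* Lagrange's identity for two terms: this square is exactly the defect in the inequality. *)
have := sqr_ge0 (u i * q - v i * p); rewrite -subr_ge0 => h.
rewrite -subr_ge0; apply: le_trans h _; rewrite le_eqVlt; apply/orP; left.
by apply/eqP; ring.
Qed.

Lemma minkowski_sum s u v : l2s s (fun i => u i + v i) <= l2s s u + l2s s v.
Proof.
rewrite -(@ler_pXn2r _ 2) ?nnegrE ?addr_ge0 ?l2s_ge0// sqr_l2s.
rewrite sqrrD !sqr_l2s.
have -> : \sum_(i <- s) (u i + v i) ^+ 2 = \sum_(i <- s) u i ^+ 2 +
    (\sum_(i <- s) u i * v i) *+ 2 + \sum_(i <- s) v i ^+ 2.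
  by rewrite -sumrMnl -!big_split; apply: eq_bigr => i _ /=; rewrite sqrrD.
by rewrite lerD2r lerD2l lerMn2r cauchy_schwarz_sum orbT.
Qed.

Lemma l2s_mono s u v : (forall i, 0 <= u i <= v i) -> l2s s u <= l2s s v.
Proof.
move=> uv; rewrite ler_wsqrtr// ler_sum// => i _.
have /andP[u0 uvi] := uv i.
by rewrite ler_pXn2r ?nnegrE//; exact: le_trans uvi.
Qed.

End FiniteSums.

Lemma esumZ (R : realType) (I : choiceType) (D : set I) (a : I -> R) (c : R) :
  0 <= c -> (forall i, 0 <= a i) ->
  \esum_(i in D) (c * a i)%:E = (c%:E * \esum_(i in D) (a i)%:E)%E.
Proof.
move=> c0 a0; rewrite /esum -ereal_supZl//; last first.
  by apply/set0P; exists (\sum_(i \in set0) (a i)%:E)%E, set0 => //; exact: fsets_set0.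
rewrite image_comp; congr ereal_sup; apply: eq_imagel => A [finA _] /=.
by rewrite ge0_mule_fsumr.
Qed.

Section HilbertSchmidt.
Variables (R : realType) (k : scalar_kind) (H : hilbertSpace R k).
Implicit Types (x y z : H).
Local Notation ip := (inner H).
Local Notation B := (hilbert_basis (H := H)).

Definition hs2 (A : H -> H) : \bar R :=
  \esum_(b in B) (rnorm (A b) ^+ 2)%:E.

Lemma hs2_ge0 A : (0 <= hs2 A)%E.
Proof. by apply: esum_ge0 => b _; rewrite lee_fin sqr_ge0. Qed.

Lemma hs_norm_ge0 (A : H -> H) : (0 <= hs_norm A)%E.
Proof. exact: sqrte_ge0. Qed.

Lemma sqr_hs_norm (A : H -> H) : (hs_norm A ^+ 2 = hs2 A)%E.
Proof. by rewrite sqr_sqrte ?hs2_ge0. Qed.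

Lemma hs_norm_fin (A : H -> H) : (hs_norm A < +oo)%E ->
  hs_norm A = (fine (hs_norm A))%:E.
Proof. by move=> h; rewrite fineK// ge0_fin_numE ?hs_norm_ge0. Qed.

Lemma hs2_fine (A : H -> H) : (hs_norm A < +oo)%E ->
  hs2 A = (fine (hs_norm A) ^+ 2)%:E.
Proof. by move=> h; rewrite -sqr_hs_norm {1}hs_norm_fin. Qed.

Lemma hs_norm_lty (A : H -> H) : (hs_norm A < +oo)%E = (hs2 A < +oo)%E.
Proof. by rewrite -!ge0_fin_numE ?hs2_ge0 ?hs_norm_ge0// sqrte_fin_num ?hs2_ge0. Qed.

Lemma fine_hs_norm_ge0 (A : H -> H) : 0 <= fine (hs_norm A).
Proof. by rewrite fine_ge0// hs_norm_ge0. Qed.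

Lemma hs_norm_scale (A : H -> H) (c : R) :
  hs_norm (fun x => ofreal k c *: A x) = (`|c|%:E * hs_norm A)%E.
Proof.
have -> : hs_norm (fun x => ofreal k c *: A x) = sqrte ((c ^+ 2)%:E * hs2 A)%E.
  congr (sqrte _); rewrite -esumZ ?sqr_ge0//; last by move=> b; rewrite sqr_ge0.
  by apply: eq_esum => b _; rewrite rnormZ exprMn sabs_ofreal real_normK ?num_real.
rewrite sqrteM ?lee_fin ?sqr_ge0//; congr (_ * _)%E.
by rewrite /= sqrtr_sqr.
Qed.

Lemma bounded_rnorm (A : H -> H) : bounded_operator A ->
  exists2 M : R, 0 <= M & forall x, rnorm (A x) <= M * rnorm x.
Proof.
move=> [M AM]; exists (sabs M); first exact: sabs_ge0.
move=> x; rewrite -(@ler_ofreal _ k) rmorphM /= !ofreal_rnorm ofreal_norm.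
apply: (le_trans (AM x)).
have <- : `|M * `|x| | = `|M| * `|x| by rewrite normrM normr_id.
by apply: real_ler_norm; apply: ger0_real; apply: le_trans (AM x).
Qed.

Lemma ler_rnorm_sum (I : Type) (s : seq I) (E : I -> H) :
  rnorm (\sum_(i <- s) E i) <= \sum_(i <- s) rnorm (E i).
Proof.
elim: s => [|i s IHs]; first by rewrite !big_nil rnorm0.
by rewrite !big_cons; apply: le_trans (ler_rnormD _ _) _; rewrite lerD2l.
Qed.

(** On a finite Fourier sum of [x] this is the Cauchy-Schwarz inequality between the coefficients
    and the [|A b|]; boundedness of [A] controls the remainder. *)
Lemma rnorm_le_hs_norm (A : {linear H -> H}) x : bounded_operator A ->
  (hs_norm A < +oo)%E -> rnorm (A x) <= fine (hs_norm A) * rnorm x.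
Proof.
move=> /bounded_rnorm[M M0 AM] /hs2_fine Afin.
set rho := fine (hs_norm A) in Afin *.
have rho0 : 0 <= rho := fine_hs_norm_ge0 A.
apply/ler_addgt0Pr => d d0.
have [y [yB yapp]] := projection_exists (@hilbert_basis_orthonormal _ _ H) x.
have xy : x = y.
  by apply/eqP; rewrite -subr_eq0; apply/eqP; exact: (@hilbert_basisP _ _ H).2.
have [s [us sB sE]] := yapp (d / (M + 1)) (divr_gt0 d0 (ltr_wpDl M0 ltr01)).
rewrite -xy in sE.
rewrite -[in X in X <= _](subrK (fourier id s x) x) linearD /=.
apply: le_trans (ler_rnormD _ _) _; rewrite addrC lerD//; last first.
  apply: (le_trans (AM _)); apply: (@le_trans _ _ ((M + 1) * (d / (M + 1)))).
    by rewrite ler_pM ?rnorm_ge0// lerDl.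
  by rewrite mulrC divfK// gt_eqF// ltr_wpDl.
rewrite linear_sum /=; apply: le_trans (ler_rnorm_sum _ _) _.
under eq_bigr do rewrite linearZ /= rnormZ.
apply: le_trans (cauchy_schwarz_sum _ _ _) _.
rewrite mulrC; apply: ler_pM; rewrite ?l2s_ge0//;
  rewrite -(@ler_pXn2r _ 2) ?nnegrE ?l2s_ge0 ?rnorm_ge0// sqr_l2s.
  by rewrite -lee_fin -Afin sum_le_esum// => b _; rewrite sqr_ge0.
exact: (bessel (@hilbert_basis_orthonormal _ _ H)).
Qed.

(** Parseval in the basis, an exchange of sums and selfadjointness turn the left side into the sum
    over [b] of the Bessel sums of [A b] in the family [f]. *)
Lemma hs2_orthonormal (I : choiceType) (D : set I) (f : I -> H) (A : {linear H -> H})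
    (s : seq I) : orthonormal_on D f -> selfadjoint A -> uniq s ->
  (forall i, i \in s -> D i) ->
  ((\sum_(i <- s) rnorm (A (f i)) ^+ 2)%:E <= hs2 A)%E.
Proof.
move=> fD Asa us sD.
rewrite -sumEFin; under eq_bigr do rewrite parseval_basis.
rewrite -esum_sum; last by move=> b i _ _; rewrite lee_fin sqip_ge0.
apply: le_esum => b Bb; rewrite sumEFin lee_fin.
under eq_bigr do rewrite /sqip Asa -/(sqip _ _) sqipC.
exact: (bessel fD).
Qed.

(** The parallelogram law, vector by vector. It stands in for the triangle inequality where only
    finiteness or moderateness is at stake. *)
Lemma hs2_sub (A C : H -> H) :
  (hs2 (fun x => A x - C x)%R <= hs2 A + hs2 A + (hs2 C + hs2 C))%E.
Proof.
rewrite /hs2 -!esumD; try by move=> *; rewrite ?adde_ge0 ?lee_fin ?sqr_ge0.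
apply: le_esum => b _; rewrite -!EFinD lee_fin rnormB2.
have := rnormD2 (A b) (C b).
have := sqr_ge0 (rnorm (A b + C b)); lra.
Qed.

End HilbertSchmidt.

(** * Existence of eigenvectors *)

Lemma sum_uniq_sub_le (R : numDomainType) (I : eqType) (s t : seq I) (a : I -> R) :
  (forall i, 0 <= a i) -> uniq s -> uniq t -> {subset s <= t} ->
  \sum_(i <- s) a i <= \sum_(i <- t) a i.
Proof.
move=> a0 us ut st; rewrite [leRHS](bigID (mem s))/=.
rewrite (_ : \sum_(i <- t | _) a i = \sum_(i <- s) a i) ?lerDl ?sumr_ge0//.
rewrite -big_filter; apply: perm_big; apply: uniq_perm => // [|i].
  exact: filter_uniq.
by rewrite mem_filter /=; case: (boolP (i \in s)) => //= /st ->.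
Qed.

Section PowerMethod.
Variables (R : realType) (k : scalar_kind) (H : hilbertSpace R k).
Implicit Types (x y z : H).
Local Notation ip := (inner H).

Section Perp.
Variables (I : choiceType) (D : set I) (f : I -> H).

Definition perp : set H := [set x | forall i, D i -> ip x (f i) = 0].

Lemma perp_closed x :
  (forall d : R, 0 < d -> exists2 y, perp y & rnorm (x - y) <= d) -> perp x.
Proof.
move=> xapp i Di; apply/eqP; rewrite -sabs_eq0 eq_le sabs_ge0 andbT.
apply: ler0_small => d d0.
have n0 : 0 < rnorm (f i) + 1 by rewrite ltr_wpDl ?rnorm_ge0.
have [y yP xy] := xapp _ (divr_gt0 d0 n0).
rewrite -[x](subrK y) ipDl yP// addr0; apply: le_trans (sabs_ip_le _ _) _.
apply: (@le_trans _ _ (d / (rnorm (f i) + 1) * (rnorm (f i) + 1))).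
  by rewrite ler_pM ?rnorm_ge0// lerDl.
by rewrite divfK// gt_eqF.
Qed.

Lemma perpZ a x : perp x -> perp (a *: x).
Proof. by move=> xP i Di; rewrite ipZl xP// mulr0. Qed.

Lemma perpD x y : perp x -> perp y -> perp (x + y).
Proof. by move=> xP yP i Di; rewrite ipDl xP// yP// addr0. Qed.

(** The witness is [x] minus its projection to the closed span of [f]. It represents the functional
    [<., x>] on the complement by a vector of the complement, where an operator leaving the
    complement invariant can be iterated. *)
Lemma perp_projection x : orthonormal_on D f ->
  exists2 y, perp y & forall w, perp w -> ip w x = ip w y.
Proof.
move=> fD; have [p [pP papp]] := projection_exists fD x.
exists (x - p) => // w wP; rewrite ipBr -[LHS]subr0; congr (_ - _).
apply/esym/eqP; rewrite -sabs_eq0 eq_le sabs_ge0 andbT.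
apply: ler0_small => d d0.
have n0 : 0 < rnorm w + 1 by rewrite ltr_wpDl ?rnorm_ge0.
have [s [us sD sE]] := papp _ (divr_gt0 d0 n0).
rewrite -[p](subrK (fourier f s x)) ipDr.
have -> : ip w (fourier f s x) = 0.
  rewrite ip_sumr big1_seq// => i /andP[_ /sD Di].
  by rewrite ipZr wP// mulr0.
rewrite addr0; apply: le_trans (sabs_ip_le _ _) _.
apply: (@le_trans _ _ ((rnorm w + 1) * (d / (rnorm w + 1)))).
  by rewrite ler_pM ?rnorm_ge0// lerDl.
by rewrite mulrC divfK// gt_eqF.
Qed.

End Perp.

(** * Power iteration for a selfadjoint contraction on an invariant complement *)

Section Contraction.
Variables (I : choiceType) (D : set I) (f : I -> H) (A : {linear H -> H}).
Hypotheses (fD : orthonormal_on D f) (Asa : selfadjoint A)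
  (Afin : (hs_norm A < +oo)%E)
  (AW : forall x, perp D f x -> perp D f (A x))
  (Acontr : forall x, perp D f x -> rnorm (A x) <= rnorm x).
Local Notation W := (perp D f).
Local Notation it n x := (iter n A x).

Lemma ip_iter n x y : ip (it n x) y = ip x (it n y).
Proof. by elim: n x y => //= n IHn x y; rewrite Asa IHn -iterSr. Qed.

Lemma perp_iter n x : W x -> W (it n x).
Proof. by move=> Wx; elim: n => //= n; exact: AW. Qed.

Lemma rip_iter m n x : rip (it m x) (it n x) = rip x (it (m + n) x).
Proof. by rewrite /rip ip_iter iterD. Qed.

Lemma rnorm_iter_le n x : W x -> rnorm (it n.+1 x) <= rnorm (it n x).
Proof. by move=> Wx; apply/Acontr/perp_iter. Qed.

Lemma rnorm_iter_antitone m n x : W x -> (m <= n)%N -> rnorm (it n x) <= rnorm (it m x).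
Proof.
move=> Wx /subnK <-; elim: (n - m)%N => // p IHp.
by rewrite addSn; apply: le_trans (rnorm_iter_le _ Wx) IHp.
Qed.

(* The moments <A^n x, x> with n even are the squared norms of the iterates, so
   |A^2m x - A^2n x|^2 = q_2m + q_2n - 2 q_(m+n) with q nonincreasing: the even
   iterates converge without any compactness argument. *)
Lemma iter_dichotomy x : W x ->
  (exists z, [/\ W z, z != 0 & A (A z) = z]) \/
  (forall d : R, 0 < d -> exists N, forall n, (N <= n)%N -> rnorm (it n x) <= d).
Proof.
move=> Wx; pose q n := rnorm (it n x) ^+ 2.
have q_anti m n : (m <= n)%N -> q n <= q m.
  by move=> mn; rewrite ler_pXn2r ?nnegrE ?rnorm_ge0// rnorm_iter_antitone.
pose E := [set q n | n in [set: nat]].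
have Einf : has_inf E.
  by split; [exists (q 0%N), 0%N|exists 0 => _ [n _ <-]; exact: sqr_ge0].
have Lq n : inf E <= q n by apply: ge_inf; [exact: Einf.2|exists n].
have qL d : 0 < d -> exists N, forall n, (N <= n)%N -> q n <= inf E + d.
  move=> d0; have [_ [N _ <-] qN] := inf_adherent d0 Einf.
  by exists N => n Nn; apply: le_trans (q_anti _ _ Nn) (ltW qN).
have [|z zP] := @rnorm_complete _ _ H (fun n => it n.*2 x).
  move=> d d0; have d20 : 0 < d ^+ 2 / 2 by rewrite divr_gt0// exprn_gt0.
  have [N NP] := qL _ d20; exists N => m n Nm Nn.
  rewrite -(@ler_pXn2r _ 2) ?nnegrE ?rnorm_ge0 ?(ltW d0)// rnormB2.
  have -> : rip (it m.*2 x) (it n.*2 x) = q (m + n)%N.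
    by rewrite rip_iter -doubleD -addnn -rip_iter ripxx.
  rewrite -!/(q _).
  have := NP m.*2; have := NP n.*2; have := Lq (m + n)%N.
  rewrite -!addnn => h1 h2 h3.
  have := h2 (leq_trans Nn (leq_addr _ _)); have := h3 (leq_trans Nm (leq_addr _ _)).
  by lra.
have Wz : W z.
  apply: perp_closed => d d0; have [N NP] := zP _ d0.
  by exists (it N.*2 x); [exact: perp_iter|rewrite rnorm_distC NP].
have [z0|z0] := eqVneq z 0; [right|left].
  move=> d d0; have [N NP] := zP _ d0; exists N.*2 => n Nn.
  apply: le_trans (rnorm_iter_antitone Wx Nn) _.
  by have := NP N; rewrite z0 subr0; apply.
exists z; split => //; apply/eqP; rewrite -subr_eq0 -rnorm_eq0 eq_le rnorm_ge0 andbT.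
apply: ler0_small => d d0; have [N NP] := zP _ (divr_gt0 d0 (ltr0Sn R 1)).
have -> : A (A z) - z = A (A (z - it N.*2 x)) + (it N.+1.*2 x - z).
  by rewrite !linearB/= addrA subrK.
apply: le_trans (ler_rnormD _ _) _; rewrite (splitr d); apply: lerD; last first.
  by rewrite NP.
have Wd : W (z - it N.*2 x).
  by rewrite -scaleN1r; apply/perpD/perpZ/perp_iter.
apply: le_trans (Acontr (AW Wd)) _; apply: le_trans (Acontr Wd) _.
by rewrite rnorm_distC NP.
Qed.

(** Some finite part of the basis carries all of [|A|^2] but [d], so lists disjoint from it share at
    most [d]. This smallness replaces compactness below. *)
Lemma hs_tail (d : R) : 0 < d -> exists t : seq H, [/\ uniq t,
  (forall b, b \in t -> hilbert_basis b) &
  forall s, uniq s -> (forall b, b \in s -> hilbert_basis b) ->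
    (forall b, b \in s -> b \notin t) -> \sum_(b <- s) rnorm (A b) ^+ 2 <= d].
Proof.
move=> d0; have AE := hs2_fine Afin; set M := _ ^+ 2 in AE.
have [t [ut tB tM]] : exists t : seq H, [/\ uniq t,
    (forall b, b \in t -> hilbert_basis b) & M - d <= \sum_(b <- t) rnorm (A b) ^+ 2].
  apply: contrapT => /forallNP nt.
  suff : (M%:E <= (M - d)%:E)%E by rewrite lee_fin; lra.
  rewrite -AE; apply: esum_le => s us sB; rewrite lee_fin leNgt; apply/negP => h.
  by apply: (nt s); split => //; exact: ltW.
exists t; split => // s us sB st.
have : \sum_(b <- t ++ s) rnorm (A b) ^+ 2 <= M.
  rewrite -lee_fin -AE; apply: sum_le_esum => [b _||b]; first exact: sqr_ge0.
    rewrite cat_uniq ut us andbT/=; apply/hasPn => b; exact: st.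
  by rewrite mem_cat => /orP[/tB|/sB].
by rewrite big_cat /=; lra.
Qed.

(** The squared norms of the iterates are moments [<A^(2n) x, x>]; their convexity is the positivity
    of [|A^n x - A^(n+2) x|^2]. *)
Lemma iter_convex n x : rnorm (it n.+1 x) ^+ 2 *+ 2 <=
  rnorm (it n x) ^+ 2 + rnorm (it n.+2 x) ^+ 2.
Proof.
have := sqr_ge0 (rnorm (it n x - it n.+2 x)); rewrite rnormB2.
have -> : rip (it n x) (it n.+2 x) = rnorm (it n.+1 x) ^+ 2.
  by rewrite rip_iter -ripxx rip_iter addnS addSn addnS.
by rewrite -mulr_natl; lra.
Qed.

(** By convexity the decrements of [|A^m x|^2] do not grow, and the first one is at most [eta].
    Almost maximal vectors thus stay large for as many steps as desired. *)
Lemma iter_lower n x (eta : R) : W x -> rnorm x <= 1 -> 1 - eta <= rnorm (A x) ^+ 2 ->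
  1 - n.+1%:R * eta <= rnorm (it n.+1 x) ^+ 2.
Proof.
move=> Wx x1 xA; pose q n := rnorm (it n x) ^+ 2.
have step m : q m - q m.+1 <= eta.
  elim: m => [|m IHm].
    have : q 0%N <= 1 by rewrite /q/= -(expr1n _ 2) ler_pXn2r ?nnegrE ?rnorm_ge0.
    by have : 1 - eta <= q 1%N := xA; lra.
  have : q m.+1 *+ 2 <= q m + q m.+2 := iter_convex m x.
  by rewrite mulr2n; lra.
rewrite -/(q n.+1); elim: n => [|n IHn]; first by rewrite mul1r.
have -> : n.+2%:R * eta = n.+1%:R * eta + eta by rewrite -natr1 mulrDl mul1r.
have := step n.+1; move: (_ * eta) IHn => c; lra.
Qed.

Lemma uniform_iter (t : seq H) (d : R) :
  (forall x, W x -> forall d : R, 0 < d ->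
    exists N, forall n, (N <= n)%N -> rnorm (it n x) <= d) ->
  0 < d -> (forall x, x \in t -> W x) ->
  exists n, forall x, x \in t -> rnorm (it n x) <= d.
Proof.
move=> h d0 tW.
suff [N NP] : exists N, forall n, (N <= n)%N -> forall x, x \in t -> rnorm (it n x) <= d.
  by exists N; exact: NP.
elim: t tW => [|x t IHt] tW; first by exists 0%N.
have [|N1 N1P] := IHt; first by move=> y yt; apply: tW; rewrite inE yt orbT.
have [N2 N2P] := h x (tW _ (mem_head _ _)) d d0.
exists (maxn N1 N2) => n; rewrite geq_max => /andP[n1 n2] y.
by rewrite inE => /orP[/eqP->|yt]; [exact: N2P|exact: N1P].
Qed.

(** If [A^2] fixes no nonzero vector of the complement, all iterates tend to 0. Write
    [|A^(n+1) x|^2] as the sum over [b] of [|<A^n x, A b>|^2]. The tail in [b] is small uniformly in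
    [x]; in the finite head the powers move to fixed vectors, so one [n] makes it small for all [x]
    in the unit ball. An almost maximal [x] for this [n] is a contradiction. *)
Lemma contraction_eigenvector :
  (forall eta : R, 0 < eta ->
    exists x, [/\ W x, rnorm x <= 1 & 1 - eta <= rnorm (A x) ^+ 2]) ->
  exists z (l : R), [/\ W z, z != 0, l != 0 & A z = ofreal k l *: z].
Proof.
move=> Anear.
suff [z [Wz z0 AAz]] : exists z, [/\ W z, z != 0 & A (A z) = z].
  (* From [A^2 z = z]: either [z] is an eigenvector for -1, or [A z + z] is one for 1. *)
  have [Azz|Azz] := eqVneq (A z + z) 0.
    exists z, (-1); split => //; rewrite ?oppr_eq0 ?oner_eq0//.
    by rewrite rmorphN1 scaleN1r; apply/eqP; rewrite -addr_eq0; apply/eqP.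
  exists (A z + z), 1; split => //; first by apply: perpD => //; exact: AW.
  by rewrite rmorph1 scale1r linearD /= AAz addrC.
apply: contrapT => nz.
have lim0 x : W x -> forall d : R, 0 < d ->
    exists N, forall n, (N <= n)%N -> rnorm (it n x) <= d.
  by move=> Wx; case: (iter_dichotomy Wx).
(* Tail and head get [1/4] each, so the total is at most [1/2], against a lower bound of [3/4]. *)
have [t [ut tB tail]] := hs_tail (ltac:(lra) : (0:R) < 4^-1).
have /choice[p pP] b : exists y, W y /\ forall w, W w -> ip w (A b) = ip w y.
  by have [y Wy yP] := perp_projection (A b) fD; exists y.
(* The head has [size t] terms, each at most [d^2]; the successor keeps [d] positive and defined by
   a true inverse when [t] is empty. *)
pose d : R := Num.sqrt (4 * (size t).+1%:R)^-1.
have c0 : 0 < (4 * (size t).+1%:R : R)^-1 by rewrite invr_gt0 mulr_gt0.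
have d0 : 0 < d by rewrite sqrtr_gt0.
have [|n nP] := @uniform_iter (map p t) d lim0 d0.
  by move=> _ /mapP[b _ ->]; exact: (pP b).1.
have head_le : \sum_(b <- t) rnorm (it n (p b)) ^+ 2 <= 4^-1.
  apply: (@le_trans _ _ (\sum_(b <- t) d ^+ 2)).
    rewrite !big_seq ler_sum// => b bt.
    by rewrite ler_pXn2r ?nnegrE ?rnorm_ge0 ?(ltW d0)// nP// map_f.
  rewrite big_const_seq count_predT iter_addr_0 /d sqr_sqrtr ?(ltW c0)//.
  rewrite -(mulr_natl _ (size t)) invfM mulrCA ler_piMr ?invr_ge0 ?ler0n//.
  by rewrite ler_pdivrMr// mul1r ler_nat.
(* The loss after [n + 1] steps is then [1/4]. The order matters: [n] is fixed before [x] is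
   chosen. *)
have eta0 : 0 < (4 * n.+1%:R : R)^-1 by rewrite invr_gt0 mulr_gt0.
have [x [Wx x1 Ax]] := Anear _ eta0.
have := iter_lower n Wx x1 Ax.
rewrite invfM mulrCA divff ?pnatr_eq0// mulr1.
suff : rnorm (it n.+1 x) ^+ 2 <= 2^-1 by move=> h1 h2; lra.
rewrite -lee_fin parseval_basis; apply: esum_le => s us sB; rewrite lee_fin.
have sqE b : sqip (it n.+1 x) b = sqip (it n x) (A b).
  by rewrite /sqip /= Asa.
pose s' := [seq b <- s | b \notin t].
apply: (@le_trans _ _ (\sum_(b <- t ++ s') sqip (it n.+1 x) b)).
  apply: sum_uniq_sub_le => [b|||b bs]; [exact: sqip_ge0|by []| |].
    rewrite cat_uniq ut filter_uniq// andbT; apply/hasPn => b.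
    by rewrite mem_filter => /andP[].
  by rewrite mem_cat mem_filter bs andbT orbN.
rewrite big_cat /= (_ : 2^-1 = 4^-1 + 4^-1 :> R); last by lra.
apply: lerD.
  apply: le_trans head_le; apply: ler_sum => b _; rewrite sqE.
  (* In the head, [<A^n x, A b> = <A^n x, p b> = <x, A^n (p b)>]. *)
  rewrite /sqip (pP b).2 ?ip_iter -?/(sqip _ _); last exact: perp_iter.
  apply: le_trans (cauchy_schwarz _ _) _.
  by rewrite ler_piMl ?sqr_ge0// -(expr1n _ 2) ler_pXn2r ?nnegrE ?rnorm_ge0.
apply: le_trans (tail s' _ _ _); last 1 first.
- by move=> b; rewrite mem_filter => /andP[].
- apply: ler_sum => b _; rewrite sqE; apply: le_trans (cauchy_schwarz _ _) _.
  rewrite ler_piMl ?sqr_ge0// -(expr1n _ 2) ler_pXn2r ?nnegrE ?rnorm_ge0//.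
  exact: le_trans (rnorm_iter_antitone Wx (leq0n n)) x1.
- exact: filter_uniq.
- by move=> b; rewrite mem_filter => /andP[_ /sB].
Qed.

End Contraction.

(** Dividing [A] by its norm [m] on the complement gives a contraction with almost maximal vectors;
    for [m = 0] the operator vanishes there. *)
Lemma selfadjoint_eigenvector (I : choiceType) (D : set I) (f : I -> H)
    (A : {linear H -> H}) :
  orthonormal_on D f -> selfadjoint A -> hilbert_schmidt A ->
  (forall x, perp D f x -> perp D f (A x)) ->
  (forall x, perp D f x -> A x = 0) \/
  exists z (l : R), [/\ perp D f z, z != 0, l != 0 & A z = ofreal k l *: z].
Proof.
move=> fD Asa [Abd Afin] AW.
pose E := [set r : R | exists x, [/\ perp D f x, rnorm x <= 1 & r = rnorm (A x)]].
have E0 : E 0.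
  exists 0; rewrite linear0 rnorm0 ler01; split => // i _; exact: ip0l.
have Esup : has_sup E.
  split; first by exists 0.
  exists (fine (hs_norm A)) => _ [x [_ x1 ->]].
  apply: le_trans (rnorm_le_hs_norm _ Abd Afin) _.
  by rewrite ler_piMr// fine_hs_norm_ge0.
set m := sup E.
have m0 : 0 <= m by apply: ub_le_sup => //; exact: Esup.2.
have Am x : perp D f x -> rnorm (A x) <= m * rnorm x.
  move=> Wx; have [->|x0] := eqVneq x 0; first by rewrite linear0 rnorm0 mulr0.
  have x0' : 0 < rnorm x by rewrite lt_def rnorm_eq0 x0 rnorm_ge0.
  rewrite -ler_pdivrMr// mulrC; apply: ub_le_sup; first exact: Esup.2.
  have ab : sabs (ofreal k (rnorm x)^-1) = (rnorm x)^-1.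
    by rewrite sabs_ofreal ger0_norm ?invr_ge0 ?rnorm_ge0.
  exists (ofreal k (rnorm x)^-1 *: x); split; first exact: perpZ.
    by rewrite rnormZ ab mulVf// gt_eqF.
  by rewrite linearZ /= rnormZ ab.
have [mE|m_neq0] := eqVneq m 0; [left|right].
  move=> x /Am; rewrite mE mul0r => h.
  by apply/eqP; rewrite -rnorm_eq0 eq_le h rnorm_ge0.
have mpos : 0 < m by rewrite lt_def m_neq0.
pose A' : {linear H -> H} := (ofreal k m^-1 \*: A).
have A'E x : A' x = ofreal k m^-1 *: A x by [].
have rA' x : rnorm (A' x) = m^-1 * rnorm (A x).
  by rewrite A'E rnormZ sabs_ofreal ger0_norm// invr_ge0.
have [||x Wx|x Wx|eta eta0|z [l [Wz z0 l0 Az]]] := @contraction_eigenvector _ D f A' fD.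
- by move=> x y; rewrite !A'E ipZl ipZr sconj_ofreal Asa.
- rewrite (_ : hs_norm A' = (`|m^-1|%:E * hs_norm A)%E); last exact: hs_norm_scale.
  by rewrite (hs_norm_fin Afin) -EFinM ltry.
- by rewrite A'E; apply/perpZ/AW.
- by rewrite rA' ler_pdivrMl// Am.
(* Half of [eta] suffices: [r > 1 - eta / 2] gives [r^2 >= 2 r - 1 > 1 - eta]. *)
- have m20 : 0 < m * (eta / 2) by rewrite mulr_gt0// divr_gt0.
  have [_ [x [Wx x1 ->]] xm] := sup_adherent m20 Esup.
  exists x; split => //; rewrite rA'.
  set r := m^-1 * _.
  have rE : rnorm (A x) = m * r by rewrite /r mulVKf.
  have : 1 - eta / 2 < r.
    by rewrite -(ltr_pM2l mpos) -rE mulrBr mulr1.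
  have := sqr_ge0 (1 - r); rewrite sqrrB expr1n mul1r; lra.
- exists z, (m * l); split => //; first by rewrite mulf_neq0.
  by rewrite rmorphM /= -scalerA -Az A'E scalerA -rmorphM /= divff// rmorph1 scale1r.
Qed.

End PowerMethod.

(** * The spectral theorem in terms of an eigenvalue enumeration *)

(** This lemma and the next translate the cardinal comparisons of [eigenvalue_enum] into lengths of
    lists. *)
Lemma card_nth_le (T : choiceType) (x0 : T) (s : seq T) (S : set T) :
  uniq s -> (forall x, x \in s -> S x) -> (`I_(size s) #<= S)%card.
Proof.
move=> us sS; apply: (@card_le_trans _ _ _ [set nth x0 s i | i in `I_(size s)]).
  rewrite (card_le_eqr (inj_card_eq _)) ?card_lexx// => i j.
  by rewrite !inE /= => si sj /eqP; rewrite nth_uniq// => /eqP.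
by apply: subset_card_le => _ [i /= si <-]; apply/sS/mem_nth.
Qed.

Lemma card_le_nth (T : choiceType) (x0 : T) (s : seq T) (S : set T) (m : nat) :
  (forall x, S x -> x \in s) -> (`I_m #<= S)%card -> (m <= size s)%N.
Proof.
move=> Ss /card_le_trans => h; rewrite -card_le_II; apply: h.
apply: card_le_trans (card_image_le (nth x0 s) `I_(size s)).
apply: subset_card_le => x /Ss xs; exists (index x s); last exact: nth_index.
by rewrite /= index_mem.
Qed.

Section EigenSequence.
Variables (R : realType) (k : scalar_kind) (H : hilbertSpace R k).
Implicit Types (x y z : H).
Local Notation ip := (inner H).

Lemma orthonormal_lin_indep m (g : 'I_m -> H) :
  orthonormal_on setT g -> lin_indep g.
Proof.
move=> gO c c0 i; have := ip0l (g i); rewrite -c0 ip_suml (bigD1 i)//= big1.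
  by rewrite ipZl gO// eqxx mulr1 addr0.
by move=> j ji; rewrite ipZl gO// (negPf ji) mulr0.
Qed.

(** Orthogonality to the [w j] imposes [n] linear equations on [m > n] coefficients. *)
Lemma orthogonal_combination m n (v : 'I_m -> H) (w : 'I_n -> H) :
  (n < m)%N -> lin_indep v ->
  exists c : 'I_m -> Defs.scalar R k, \sum_(i < m) c i *: v i != 0 /\
    forall j, ip (\sum_(i < m) c i *: v i) (w j) = 0.
Proof.
move=> nm vi; pose M := \matrix_(i < m, j < n) ip (v i) (w j).
have : kermx M != 0.
  rewrite kermx_eq0 /row_free; apply/eqP => rM.
  by have := rank_leq_col M; rewrite rM leqNgt nm.
move=> /rowV0Pn[x /sub_kermxP xM x0].
exists (fun i => x 0 i); split.
  apply: contra x0 => /eqP/vi c0; apply/eqP/rowP => i; by rewrite c0 mxE.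
move=> j; have := congr1 (fun N : 'rV[_]_n => N 0 j) xM; rewrite !mxE => <-.
by rewrite ip_suml; apply: eq_bigr => i _; rewrite ipZl mxE.
Qed.

Variables (A : {linear H -> H}) (a : nat -> R).
Hypotheses (Asa : selfadjoint A) (aE : eigenvalue_enum A a).

(** Only the values of [u] below [n] matter; a total function makes extension by one vector easy to
    state. *)
Definition partial_eigenbasis n (u : nat -> H) : Prop :=
  (forall i j, (i < n)%N -> (j < n)%N -> ip (u i) (u j) = (i == j)%:R) /\
  (forall i, (i < n)%N -> A (u i) = ofreal k (a i) *: u i).

Lemma eigenvectors_orthogonal x y (l m : R) : l != m ->
  A x = ofreal k l *: x -> A y = ofreal k m *: y -> ip x y = 0.
Proof.
move=> lm Ax Ay; have := Asa x y; rewrite Ax Ay ipZl ipZr sconj_ofreal => /eqP.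
rewrite -subr_eq0 -mulrBl mulf_eq0 => /orP[|/eqP//].
by rewrite -rmorphB fmorph_eq0 subr_eq0 (negPf lm).
Qed.

(** If [s] lists the earlier indices with value [a n], then [n] is one more, so the eigenspace has
    [size s + 1] independent vectors and some combination is orthogonal to the vectors used so far.
    Eigenvectors for other values are orthogonal anyway. *)
Lemma partial_eigenbasis_extend n u : partial_eigenbasis n u ->
  exists v, [/\ ip v v = 1, A v = ofreal k (a n) *: v &
    forall i, (i < n)%N -> ip v (u i) = 0].
Proof.
move=> [uO uA]; pose s := [seq i <- iota 0 n | a i == a n].
have /aE[v [vi vA]] : (`I_(size s).+1 #<=
    [set i | ofreal k (a i) = ofreal k (a n)])%card.
  have -> : (size s).+1 = size (n :: s) by [].
  apply: (card_nth_le 0%N) => /=.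
    by rewrite filter_uniq ?iota_uniq// andbT mem_filter mem_iota ltnn !andbF.
  by move=> i; rewrite inE mem_filter => /orP[/eqP->|/andP[/eqP->]].
have [c [x0 xs]] := @orthogonal_combination _ _ v
  (fun j : 'I_(size s) => u (nth 0%N s j)) (ltnSn _) vi.
set x := \sum_i _ in x0 xs.
have Ax : A x = ofreal k (a n) *: x.
  rewrite linear_sum scaler_sumr; apply: eq_bigr => i _ /=.
  by rewrite linearZ /= vA scalerA mulrC -scalerA.
exists (ofreal k (rnorm x)^-1 *: x); split.
- exact: normalizedP.
- by rewrite linearZ /= Ax scalerA mulrC -scalerA.
- move=> i ni; rewrite ipZl; have [ain|ain] := eqVneq (a i) (a n).
    have is_ : i \in s by rewrite mem_filter ain eqxx mem_iota.
    have si : (index i s < size s)%N by rewrite index_mem.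
    by have := xs (Ordinal si); rewrite /= nth_index// => ->; rewrite mulr0.
  by rewrite ipC (eigenvectors_orthogonal ain (uA _ ni) Ax) rmorph0 mulr0.
Qed.

(** Dependent choice yields partial eigenbases each extending the previous one; the sequence is
    their diagonal. *)
Lemma eigen_sequence : exists u : nat -> H, orthonormal_on setT u /\
  forall n, A (u n) = ofreal k (a n) *: u n.
Proof.
pose X := {p : nat * (nat -> H) | partial_eigenbasis p.1 p.2}.
pose next (p q : X) := (sval q).1 = (sval p).1.+1 /\
  forall i, (i < (sval p).1)%N -> (sval q).2 i = (sval p).2 i.
have step (p : X) : {q : X | next p q}.
  apply: cid; case: p => -[n u] /= up.
  have [v [vv vA vu]] := partial_eigenbasis_extend up.
  pose u' i := if (i < n)%N then u i else v.
  have u'P : partial_eigenbasis n.+1 u'.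
    split=> [i j|i]; rewrite !ltnS /u'; last first.
      rewrite leq_eqVlt; case: ltnP => [ni _|_]; first exact: up.2.
      by rewrite orbF => /eqP ->.
    rewrite (leq_eqVlt i) (leq_eqVlt j).
    case: ltnP => [ni _|_].
      case: ltnP => [nj _|_]; first exact: up.1.
      rewrite orbF => /eqP ->; rewrite ipC vu// rmorph0.
      by rewrite ltn_eqF.
    rewrite orbF => /eqP ->; case: ltnP => [nj _|_].
      by rewrite vu// gtn_eqF.
    by rewrite orbF => /eqP ->; rewrite vv eqxx.
  exists (exist _ (n.+1, u') u'P); split => //= i ni.
  by rewrite /u' ni.
have p0 : partial_eigenbasis 0 (fun=> 0) by split.
have [f [f0 fS]] := dependent_choice step (exist _ (0%N, fun=> 0) p0).
have f1 n : (sval (f n)).1 = n.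
  by elim: n => [|n IHn]; [rewrite f0|rewrite (fS n).1 IHn].
have fE n i : (i < n)%N -> (sval (f n)).2 i = (sval (f i.+1)).2 i.
  elim: n => // n IHn; rewrite ltnS leq_eqVlt => /orP[/eqP->//|ni].
  by rewrite (fS n).2 ?f1// IHn.
exists (fun n => (sval (f n.+1)).2 n); split=> [i j _ _|n]; last first.
  by have [_] := svalP (f n.+1); rewrite f1; apply.
have [+ _] := svalP (f (maxn i j).+1); rewrite f1 => h.
have := h i j; rewrite !ltnS leq_maxl leq_maxr => /(_ isT isT) <-.
by rewrite !(fE (maxn i j).+1) ?ltnS ?leq_maxl ?leq_maxr.
Qed.

Hypothesis Ahs : hilbert_schmidt A.
Variable u : nat -> H.
Hypotheses (uO : orthonormal_on setT u)
  (uA : forall n, A (u n) = ofreal k (a n) *: u n).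

Lemma rnorm_eigen n : rnorm (A (u n)) ^+ 2 = a n ^+ 2.
Proof.
by rewrite uA rnormZ (rnorm_orthonormal uO)// mulr1 sabs_ofreal real_normK ?num_real.
Qed.

Lemma sum_eigen_le_hs2 (s : seq nat) : uniq s ->
  ((\sum_(n <- s) a n ^+ 2)%:E <= hs2 A)%E.
Proof.
move=> us; under eq_bigr do rewrite -rnorm_eigen.
exact: (hs2_orthonormal uO).
Qed.

(** Otherwise the complement contains an eigenvector [z] with value [l != 0]. Each listing of [l]
    contributes [l^2] to the finite [|A|^2], so [l] is listed finitely often, say [c] times; the
    corresponding [u n] together with [z] are [c + 1] independent eigenvectors, against the
    enumeration. *)
Lemma eigen_perp_null x : perp setT u x -> A x = 0.
Proof.
have uW y : perp setT u y -> perp setT u (A y).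
  by move=> yu n _; rewrite Asa uA ipZr yu// mulr0.
have [//|[z [l [zu z0 l0 zA]]]] := selfadjoint_eigenvector uO Asa Ahs uW; first exact.
exfalso.
have l2 : 0 < l ^+ 2 by rewrite lt_def sqrf_eq0 l0 sqr_ge0.
pose P (m : nat) := exists s, [/\ uniq s, (forall n, n \in s -> a n = l) & size s = m].
have P0 : exists m, `[< P m >] by exists 0%N; apply/asboolP; exists [::].
have Pub m : `[< P m >] -> (m <= Num.truncn (fine (hs_norm A) ^+ 2 / l ^+ 2))%N.
  move=> /asboolP[s [us sl <-]].
  rewrite truncn_ge_nat ?divr_ge0 ?sqr_ge0// ler_pdivlMr//.
  rewrite -lee_fin -(hs2_fine Ahs.2); apply: le_trans (sum_eigen_le_hs2 us).
  rewrite lee_fin big_seq; under eq_bigr => n ns do rewrite sl//.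
  by rewrite -big_seq big_const_seq count_predT iter_addr_0 mulr_natl.
case: (ex_maxnP P0 Pub) => c /asboolP[s [us sl sc]] cmax.
have Ss n : a n = l -> n \in s.
  move=> nl; apply/negPn/negP => ns.
  suff : (c.+1 <= c)%N by rewrite ltnn.
  apply/cmax/asboolP; exists (n :: s); split => /=; rewrite ?ns ?sc//.
  by move=> i; rewrite inE => /orP[/eqP->//|/sl].
pose z' := ofreal k (rnorm z)^-1 *: z.
have z'z' : ip z' z' = 1 by apply: normalizedP.
have z'u n : ip z' (u n) = 0 by rewrite ipZl zu// mulr0.
pose g (i : 'I_c.+1) := if (i < c)%N then u (nth 0%N s i) else z'.
have gO : orthonormal_on setT g.
  move=> i j _ _; rewrite /g; case: ltnP => ic; case: ltnP => jc.
  - by rewrite uO// nth_uniq ?sc.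
  - by rewrite ipC z'u rmorph0 -val_eqE/= ltn_eqF// (leq_trans ic).
  - by rewrite z'u -val_eqE/= gtn_eqF// (leq_trans jc).
  - have ij : i = j.
      by apply/val_inj => /=; have := ltn_ord i; have := ltn_ord j; lia.
    by rewrite ij z'z' eqxx.
have : (`I_c.+1 #<= [set n | ofreal k (a n) = ofreal k l])%card.
  apply/aE; exists g; split; first exact: orthonormal_lin_indep.
  move=> i; rewrite /g; case: ltnP => ic; first by rewrite uA sl// mem_nth ?sc.
  by rewrite linearZ /= zA scalerA mulrC -scalerA.
have inS n : [set n | ofreal k (a n) = ofreal k l] n -> n \in s.
  by move=> /ofreal_inj/Ss.
by move=> /(card_le_nth 0%N inS); rewrite sc ltnn.
Qed.

(** The family [u] need not span the space, but every [A b] lies in its closed span, since [A] kills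
    the complement. Parseval for [A b] in [u] and Bessel for [u n] in the basis then give the upper
    bound. *)
Lemma hs2_eigen : hs2 A = \esum_(n in [set: nat]) (a n ^+ 2)%:E.
Proof.
apply/eqP; rewrite eq_le; apply/andP; split; last first.
  by apply: esum_le => s us _; exact: sum_eigen_le_hs2.
apply: esum_le => s us sB; rewrite -sumEFin.
apply: (@le_trans _ _ (\sum_(b <- s) \esum_(n in [set: nat]) (sqip (A b) (u n))%:E)%E).
  apply: lee_sum => b _; apply: (parseval_le uO) => y yu.
  by rewrite Asa eigen_perp_null ?ip0r.
rewrite -esum_sum; last by move=> n b _ _; rewrite lee_fin sqip_ge0.
apply: le_esum => n _; rewrite sumEFin lee_fin.
under eq_bigr do rewrite /sqip Asa uA -/(sqip _ _) sqipZr sabs_ofreal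
  real_normK ?num_real// sqipC.
rewrite -mulr_sumr ler_piMr ?sqr_ge0//.
apply: le_trans (bessel (@hilbert_basis_orthonormal _ _ H) us sB _) _.
by rewrite (rnorm_orthonormal uO)// expr1n.
Qed.

End EigenSequence.

Lemma l2norm_esum (R : realType) (v : nat -> R) :
  l2norm v = sqrte (\esum_(n in [set: nat]) (v n ^+ 2)%:E).
Proof.
rewrite /l2norm nneseries_esumT; last by move=> n; rewrite lee_fin sqr_ge0.
by congr sqrte; apply: eq_esum => n _; rewrite real_normK ?num_real.
Qed.

Lemma l2norm_eigen (R : realType) (k : scalar_kind) (H : hilbertSpace R k)
    (A : {linear H -> H}) (a : nat -> R) :
  selfadjoint A -> hilbert_schmidt A -> eigenvalue_enum A a ->
  l2norm a = hs_norm A.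
Proof.
move=> Asa Ahs aE; have [u [uO uA]] := eigen_sequence Asa aE.
by rewrite l2norm_esum -(hs2_eigen Asa aE Ahs uO uA).
Qed.

(** * Doubly stochastic matrices *)

Section Assignment.
Variable R : realFieldType.

Definition doubly_stochastic n (p : 'I_n -> 'I_n -> R) : Prop :=
  [/\ forall i j, 0 <= p i j, forall i, \sum_j p i j = 1 &
      forall j, \sum_i p i j = 1].

(* Instead of decomposing p into permutations (Birkhoff), move the mass of the
   row of the largest a and the column of the largest b onto their common entry;
   this can only increase the sum. *)
Lemma doubly_stochastic_assignment n (p : 'I_n -> 'I_n -> R) (a b : 'I_n -> R) :
  doubly_stochastic p ->
  exists s : {perm 'I_n}, \sum_i \sum_j p i j * (a i * b j) <= \sum_i a i * b (s i).
Proof.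
elim: n p a b => [|n IHn] p a b [p0 pr pc].
  by exists 1%g; rewrite !big_ord0.
have [i0 ai0] : exists i0, forall i, a i <= a i0.
  by exists [arg max_(i > ord0) a i]%O; case: arg_maxP => // i _ h j; exact: h.
have [j0 bj0] : exists j0, forall j, b j <= b j0.
  by exists [arg max_(i > ord0) b i]%O; case: arg_maxP => // i _ h j; exact: h.
(* The rest of column [j0], the rest of row [i0], and their common mass. *)
pose r i := p (lift i0 i) j0; pose t j := p i0 (lift j0 j); pose q := 1 - p i0 j0.
have rq : \sum_i r i = q by rewrite /q -(pc j0) (bigD1_ord i0)//= addrAC subrr add0r.
have tq : \sum_j t j = q by rewrite /q -(pr i0) (bigD1_ord j0)//= addrAC subrr add0r.
have r0 i : 0 <= r i by exact: p0.
have t0 j : 0 <= t j by exact: p0.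
have q0 : 0 <= q by rewrite -rq sumr_ge0.
(* For [q = 0] the quotient is 0, but then every [r i] vanishes too; the factor [q / q] thus treats
   both cases at once. *)
have rV i : r i * (q / q) = r i.
  have [qE|qn] := eqVneq q 0; last by rewrite divff// mulr1.
  have /eqP := rq; rewrite qE psumr_eq0// => /allP/(_ i (mem_index_enum i))/eqP ->.
  by rewrite mul0r.
have tV j : t j * (q / q) = t j.
  have [qE|qn] := eqVneq q 0; last by rewrite divff// mulr1.
  have /eqP := tq; rewrite qE psumr_eq0// => /allP/(_ j (mem_index_enum j))/eqP ->.
  by rewrite mul0r.
(* Row [i] has lost [r i] and column [j] has lost [t j]; the rank one matrix [r i t j / q] restores
   both marginals. *)
pose p' i j := p (lift i0 i) (lift j0 j) + r i * t j / q.
have [|s sP] := IHn p' (fun i => a (lift i0 i)) (fun j => b (lift j0 j)).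
  split=> [i j|i|j].
  - by rewrite addr_ge0 ?p0// divr_ge0// mulr_ge0.
  - rewrite big_split/= -mulr_suml -mulr_sumr tq -mulrA rV /r.
    by rewrite -(pr (lift i0 i)) (bigD1_ord j0)//= addrC.
  - rewrite big_split/= -mulr_suml -mulr_suml rq mulrAC [q / q * _]mulrC tV /t.
    by rewrite -(pc (lift j0 j)) (bigD1_ord i0)//= addrC.
exists (lift_perm i0 j0 s).
rewrite [leRHS](bigD1_ord i0)//= lift_perm_id.
under [X in _ <= _ + X]eq_bigr do rewrite lift_perm_lift.
apply: le_trans (lerD (lexx _) sP).
rewrite (bigD1_ord i0)//= (bigD1_ord j0)//=.
under [X in _ + X <= _]eq_bigr do rewrite (bigD1_ord j0)//=.
rewrite big_split /=.
set S := \sum_(i < n) \sum_(j < n) p _ _ * _.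
pose X := \sum_i r i * a (lift i0 i); pose Y := \sum_j t j * b (lift j0 j).
have -> : \sum_(i < n) \sum_(j < n) p' i j * (a (lift i0 i) * b (lift j0 j)) =
    S + X * Y / q.
  rewrite /S /X mulr_suml mulr_suml -big_split; apply: eq_bigr => i _ /=.
  rewrite /Y mulr_sumr mulr_suml -big_split; apply: eq_bigr => j _ /=.
  by rewrite /p'; ring.
have -> : \sum_(i < n) p (lift i0 i) j0 * (a (lift i0 i) * b j0) = X * b j0.
  by rewrite /X mulr_suml; apply: eq_bigr => i _; rewrite mulrA.
have -> : \sum_(j < n) p i0 (lift j0 j) * (a i0 * b (lift j0 j)) = a i0 * Y.
  by rewrite /Y mulr_sumr; apply: eq_bigr => i _; rewrite mulrCA.
have Xq : X <= q * a i0.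
  by rewrite -rq mulr_suml ler_sum// => i _; rewrite ler_wpM2l.
have Yq : Y <= q * b j0.
  by rewrite -tq mulr_suml ler_sum// => i _; rewrite ler_wpM2l.
have XV : X * (q / q) = X.
  by rewrite /X mulr_suml; apply: eq_bigr => i _; rewrite mulrAC rV.
have YV : Y * (q / q) = Y.
  by rewrite /Y mulr_suml; apply: eq_bigr => i _; rewrite mulrAC tV.
have qV : q * (q / q) = q.
  by have [->|qn] := eqVneq q 0; [rewrite mul0r|rewrite divff// mulr1].
(* This product is the gain from moving the mass, nonnegative because [a i0] and [b j0] are
   maximal. *)
have : 0 <= (q * a i0 - X) * (q * b j0 - Y) / q.
  by rewrite divr_ge0// mulr_ge0// subr_ge0.
have -> : (q * a i0 - X) * (q * b j0 - Y) / q =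
   (q * (q / q)) * a i0 * b j0 - a i0 * (Y * (q / q)) - (X * (q / q)) * b j0
   + X * Y / q by ring.
rewrite qV YV XV {1}/q; lra.
Qed.

Definition zero_pad n (c : 'I_n -> R) (i : 'I_(n + n)) : R :=
  if fintype.split i is inl i' then c i' else 0.

(** The matrix [p] is the upper left block of a doubly stochastic one: the off-diagonal blocks are
    diagonal and hold the row and column defects, the last block is the transpose of [p]. The zero
    padding makes the new entries weightless. *)
Lemma substochastic_assignment n (p : 'I_n -> 'I_n -> R) (a b : 'I_n -> R) :
  (forall i j, 0 <= p i j) -> (forall i, \sum_j p i j <= 1) ->
  (forall j, \sum_i p i j <= 1) ->
  exists s : {perm 'I_(n + n)},
    \sum_i \sum_j p i j * (a i * b j) <= \sum_i zero_pad a i * zero_pad b (s i).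
Proof.
move=> p0 pr pc.
have split_lshift (i : 'I_n) : fintype.split (lshift n i) = inl i by exact: (unsplitK (inl i)).
have split_rshift (i : 'I_n) : fintype.split (rshift n i) = inr i by exact: (unsplitK (inr i)).
pose P (i j : 'I_(n + n)) := match fintype.split i, fintype.split j with
  | inl i, inl j => p i j
  | inl i, inr j => (i == j)%:R * (1 - \sum_j p i j)
  | inr i, inl j => (i == j)%:R * (1 - \sum_i p i j)
  | inr i, inr j => p j i end.
have diag (i : 'I_n) (c : R) : \sum_j (i == j)%:R * c = c.
  rewrite (bigD1 i)//= eqxx mul1r big1 ?addr0// => j ji.
  by rewrite eq_sym (negPf ji) mul0r.
have diag' (j : 'I_n) (c : 'I_n -> R) : \sum_i (i == j)%:R * c i = c j.
  rewrite (bigD1 j)//= eqxx mul1r big1 ?addr0// => i ij.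
  by rewrite (negPf ij) mul0r.
have [|s sP] := @doubly_stochastic_assignment _ P (zero_pad a) (zero_pad b).
  split=> [i j|i|j].
  - rewrite /P; case: (fintype.split i) => i'; case: (fintype.split j) => j' //;
      by rewrite mulr_ge0 ?ler0n// subr_ge0.
  - rewrite big_split_ord /= /P; case: (fintype.split i) => i'.
      under eq_bigr do rewrite split_lshift; under [X in _ + X]eq_bigr do rewrite split_rshift.
      by rewrite diag addrC subrK.
    under eq_bigr do rewrite split_lshift; under [X in _ + X]eq_bigr do rewrite split_rshift.
    under eq_bigr do rewrite eq_sym.
    by rewrite diag' subrK.
  - rewrite big_split_ord /= /P; case: (fintype.split j) => j'.
      under eq_bigr do rewrite split_lshift; under [X in _ + X]eq_bigr do rewrite split_rshift.
      under [X in _ + X]eq_bigr do rewrite eq_sym.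
      by rewrite diag addrC subrK.
    under eq_bigr do rewrite split_lshift; under [X in _ + X]eq_bigr do rewrite split_rshift.
    by rewrite diag' subrK.
exists s; apply: le_trans sP; rewrite big_split_ord /=.
rewrite [X in _ <= _ + X]big1 ?addr0; last first.
  by move=> i _; rewrite big1// => j _; rewrite /zero_pad split_rshift mul0r mulr0.
rewrite le_eqVlt; apply/orP; left; apply/eqP; apply: eq_bigr => i _.
rewrite big_split_ord /= [X in _ = _ + X]big1 ?addr0; last first.
  by move=> j _; rewrite /zero_pad split_rshift !mulr0.
by apply: eq_bigr => j _; rewrite /P /zero_pad !split_lshift.
Qed.

End Assignment.

(** * The Hoffman-Wielandt inequality *)

Section HoffmanWielandt.
Variables (R : realType) (k : scalar_kind) (H : hilbertSpace R k).
Implicit Types (x y z : H) (F f g : seq H).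
Local Notation ip := (inner H).

(** Gram-Schmidt on [vs]. Membership in the span is recorded as the converse of Bessel's inequality,
    the form in which it is used. *)
Lemma orthonormal_completion f (vs : seq H) :
  uniq f -> orthonormal_on [set` f] id ->
  exists g, [/\ uniq (f ++ g), orthonormal_on [set` f ++ g] id &
    forall x, x \in vs -> rnorm x ^+ 2 <= \sum_(e <- f ++ g) sqip x e].
Proof.
move=> uf fO; elim: vs => [|x vs [g [uF FO gP]]]; first by exists [::]; rewrite cats0.
set F := f ++ g in uF FO gP; pose y := x - fourier id F x.
have inF e : e \in F -> [set` F] e by [].
have xE : rnorm x ^+ 2 = rnorm y ^+ 2 + \sum_(e <- F) sqip x e.
  by rewrite (rnorm_sub_fourier FO)// subrK.
have [y0|y0] := eqVneq y 0.
  exists g; split => // z; rewrite inE => /orP[/eqP->|/gP//].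
  by rewrite xE y0 rnorm0 expr0n add0r.
have ny : rnorm y != 0 by rewrite rnorm_eq0.
pose w := ofreal k (rnorm y)^-1 *: y.
have ww : ip w w = 1 by apply: normalizedP.
have we e : e \in F -> ip w e = 0.
  by move=> eF; rewrite ipZl (ip_sub_fourier FO)// mulr0.
have ew e : e \in F -> ip e w = 0 by move=> eF; rewrite ipC we// rmorph0.
have wF : w \notin F.
  by apply/negP => /we; rewrite ww => /eqP; rewrite oner_eq0.
exists (rcons g w); rewrite -rcons_cat; split.
- by rewrite rcons_uniq wF.
- move=> a b; rewrite /= !mem_rcons !inE => /orP[/eqP->|aF] /orP[/eqP->|bF].
  + by rewrite ww eqxx.
  + by rewrite we//; case: eqP => // wb; rewrite wb bF in wF.
  + by rewrite ew//; case: eqP => // aw; rewrite -aw aF in wF.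
  + exact: FO.
- move=> z; rewrite inE -cats1 big_cat/= big_seq1 => /orP[/eqP->|/gP zF]; last first.
    by apply: le_trans zF _; rewrite lerDl sqip_ge0.
  rewrite xE [leRHS]addrC lerD2r /sqip -[x](subrK (fourier id F x)) -/y ipDl.
  rewrite [X in _ + X](_ : _ = 0); last first.
    by rewrite ip_suml big1_seq// => e /andP[_ eF]; rewrite ipZl ew// mulr0.
  rewrite addr0 ipZr ipxx sconj_ofreal -rmorphM /= sabs_ofreal expr2 mulKf//.
  by rewrite ger0_norm ?rnorm_ge0.
Qed.

Section Truncation.
Variables (A : {linear H -> H}) (a : nat -> R) (u : nat -> H) (N : nat).
Hypotheses (Asa : selfadjoint A) (uO : orthonormal_on setT u)
  (uA : forall n, A (u n) = ofreal k (a n) *: u n).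

(** The operator with eigenvalues [a n] for [n < N] and zero elsewhere, written as a Fourier sum of
    [A x] so that [A x - truncation x] is a Fourier remainder. *)
Definition truncation x : H := fourier u (iota 0 N) (A x).

Lemma sqip_eigen x n : sqip (A x) (u n) = a n ^+ 2 * sqip x (u n).
Proof. by rewrite {1}/sqip Asa uA -/(sqip _ _) sqipZr sabs_ofreal real_normK ?num_real. Qed.

Lemma rnorm_truncation x :
  rnorm (truncation x) ^+ 2 = \sum_(n <- iota 0 N) a n ^+ 2 * sqip x (u n).
Proof.
rewrite (rnorm_fourier uO) ?iota_uniq//.
by apply: eq_bigr => n _; exact: sqip_eigen.
Qed.

Lemma rip_truncation x :
  rip x (truncation x) = \sum_(n <- iota 0 N) a n * sqip x (u n).
Proof.
rewrite rip_comb; apply: eq_bigr => n _.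
rewrite Asa uA ipZr sconj_ofreal rmorphM /= sconj_ofreal -mulrA sreZ.
by congr (_ * _); rewrite mulrC mul_sconj sreK.
Qed.

Lemma truncation_eigen n : (n < N)%N -> truncation (u n) = ofreal k (a n) *: u n.
Proof.
move=> nN; rewrite /truncation /fourier (bigD1_seq n) ?iota_uniq ?mem_iota//=.
rewrite uA ipZl uO// eqxx mulr1 big1 ?addr0// => i ni.
by rewrite ipZl uO// eq_sym (negPf ni) mulr0 scale0r.
Qed.

Lemma truncation_perp x : (forall n, (n < N)%N -> ip x (u n) = 0) -> truncation x = 0.
Proof.
move=> xu; rewrite /truncation /fourier big1_seq// => n /andP[_].
by rewrite mem_iota /= => nN; rewrite Asa uA ipZr xu// mulr0 scale0r.
Qed.

Variables (F : seq H).
Hypotheses (uF : uniq F) (FO : orthonormal_on [set` F] id)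
  (Fspan : forall n, (n < N)%N -> rnorm (u n) ^+ 2 <= \sum_(e <- F) sqip (u n) e).

(** After exchanging sums, [a n ^+ 2] is weighted by the Bessel sum of [u n] in [F], which is at
    least 1 because [F] spans [u n]. *)
Lemma sum_rnorm_truncation :
  \sum_(n <- iota 0 N) a n ^+ 2 <= \sum_(e <- F) rnorm (truncation e) ^+ 2.
Proof.
under [leRHS]eq_bigr do rewrite rnorm_truncation.
rewrite exchange_big /= !big_seq ler_sum// => n; rewrite mem_iota /= => nN.
rewrite -mulr_sumr ler_peMr ?sqr_ge0//.
under eq_bigr do rewrite sqipC.
by apply: le_trans (Fspan nN); rewrite (rnorm_orthonormal uO)// expr1n.
Qed.

(** Pythagoras for each [e]; the squares [|A e|^2] add up to at most [|A|^2]. *)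
Lemma truncation_error M : hs2 A = M%:E ->
  \sum_(e <- F) rnorm (A e - truncation e) ^+ 2 <= M - \sum_(n <- iota 0 N) a n ^+ 2.
Proof.
move=> AM.
under eq_bigr do rewrite (rnorm_sub_fourier uO) ?iota_uniq//
  -(rnorm_fourier uO) ?iota_uniq// -/(truncation _).
rewrite sumrB lerD// ?lerN2 ?sum_rnorm_truncation//.
by rewrite -lee_fin -AM (hs2_orthonormal FO).
Qed.

End Truncation.

(** On [g], orthogonal to the [u i], the truncation of [A] vanishes. On [u i] the square is
    expanded, with cross term [a i <u i, B_N (u i)>]. The squares of [B_N] over all of [F] dominate
    the sum of the [b j ^+ 2]. *)
Lemma truncation_gap (A B : {linear H -> H}) (a b : nat -> R) (u v : nat -> H) N g :
  selfadjoint A -> selfadjoint B ->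
  orthonormal_on setT u -> orthonormal_on setT v ->
  (forall n, A (u n) = ofreal k (a n) *: u n) ->
  (forall n, B (v n) = ofreal k (b n) *: v n) ->
  let F := map u (iota 0 N) ++ g in
  uniq F -> orthonormal_on [set` F] id ->
  (forall n, (n < N)%N -> rnorm (v n) ^+ 2 <= \sum_(e <- F) sqip (v n) e) ->
  \sum_(i <- iota 0 N) a i ^+ 2 + \sum_(j <- iota 0 N) b j ^+ 2 -
    2 * \sum_(i <- iota 0 N) \sum_(j <- iota 0 N) sqip (u i) (v j) * (a i * b j) <=
  \sum_(e <- F) rnorm (truncation A u N e - truncation B v N e) ^+ 2.
Proof.
move=> Asa Bsa uO vO uA vB F uF FO Fspan.
have bF := sum_rnorm_truncation Bsa vO vB Fspan.
move: uF FO bF; rewrite {}/F in Fspan * => uF FO; rewrite !big_cat /= !big_map => bF.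
have -> : \sum_(e <- g) rnorm (truncation A u N e - truncation B v N e) ^+ 2 =
    \sum_(e <- g) rnorm (truncation B v N e) ^+ 2.
  rewrite !big_seq; apply: eq_bigr => e eg.
  rewrite (truncation_perp Asa uA) ?sub0r ?rnormN// => n nN.
  have un : u n \in map u (iota 0 N) by rewrite map_f// mem_iota.
  have ne : e != u n.
    apply/eqP => eu; move: uF; rewrite cat_uniq => /and3P[_ /hasPn/(_ _ eg)] /=.
    by rewrite eu un.
  by rewrite FO/= ?mem_cat ?eg ?un ?orbT// (negPf ne).
have -> : \sum_(i <- iota 0 N) rnorm (truncation A u N (u i) - truncation B v N (u i)) ^+ 2
  = \sum_(i <- iota 0 N) a i ^+ 2 - 2 * \sum_(i <- iota 0 N)
      \sum_(j <- iota 0 N) sqip (u i) (v j) * (a i * b j)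
    + \sum_(i <- iota 0 N) rnorm (truncation B v N (u i)) ^+ 2.
  rewrite mulr_sumr -sumrB -big_split /= !big_seq; apply: eq_bigr => i.
  rewrite mem_iota /= => iN; rewrite (truncation_eigen uO uA iN) rnormB2; congr (_ - _ + _).
    by rewrite rnormZ (rnorm_orthonormal uO)// mulr1 sabs_ofreal real_normK ?num_real.
  congr (_ * _); rewrite /rip ipZl sreZ -/(rip _ _) (rip_truncation _ Bsa vB) mulr_sumr.
  by apply: eq_bigr => j _; rewrite mulrA mulrC.
lra.
Qed.

End HoffmanWielandt.

Lemma sum_iota (V : nmodType) n (E : nat -> V) :
  \sum_(i <- iota 0 n) E i = \sum_(i < n) E i.
Proof. by rewrite -(big_mkord xpredT) /index_iota subn0. Qed.

Section SquareSummable.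
Variable R : realType.
Implicit Types (a : nat -> R) (s : seq nat).

Lemma l2norm_le a (c : R) : 0 <= c ->
  (forall s, uniq s -> l2s s a <= c) -> (l2norm a <= c%:E)%E.
Proof.
move=> c0 h; rewrite l2norm_esum -[c%:E]/(EFin c) -(ger0_norm c0) -sqrtr_sqr.
rewrite -[(Num.sqrt _)%:E]/(sqrte (c ^+ 2)%:E) lee_sqrt ?lee_fin ?sqr_ge0//.
apply: esum_le => s us _; rewrite lee_fin -sqr_l2s.
by rewrite ler_pXn2r ?nnegrE ?l2s_ge0// h.
Qed.

Definition head_seq a N n : R := if (n < N)%N then a n else 0.

Lemma square_sum_tail a (M : R) : \esum_(n in [set: nat]) (a n ^+ 2)%:E = M%:E ->
  forall d : R, 0 < d -> exists N, forall N', (N <= N')%N ->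
    M - \sum_(n <- iota 0 N') a n ^+ 2 <= d /\
    forall s, uniq s -> \sum_(n <- s) (a n - head_seq a N' n) ^+ 2 <= d.
Proof.
move=> aM d d0.
have [t [ut tM]] : exists t, uniq t /\ M - d <= \sum_(n <- t) a n ^+ 2.
  apply: contrapT => /forallNP nt.
  suff : (M%:E <= (M - d)%:E)%E by rewrite lee_fin; lra.
  rewrite -aM; apply: esum_le => s us _; rewrite lee_fin leNgt; apply/negP => h.
  by apply: (nt s); split => //; exact: ltW.
exists (\max_(n <- t) n).+1 => N tN.
have hN : M - d <= \sum_(n <- iota 0 N) a n ^+ 2.
  apply: (le_trans tM); apply: sum_uniq_sub_le => [n|||n nt] //.
  - exact: sqr_ge0.
  - exact: iota_uniq.
  - rewrite mem_iota add0n /=; apply: leq_trans tN; rewrite ltnS.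
    exact: leq_bigmax_seq.
split=> [|s us]; first by lra.
pose s' := [seq n <- s | (N <= n)%N].
have -> : \sum_(n <- s) (a n - head_seq a N n) ^+ 2 = \sum_(n <- s') a n ^+ 2.
  rewrite big_filter [RHS]big_mkcond; apply: eq_bigr => n _.
  by rewrite /head_seq; case: ltnP => _; rewrite ?subrr ?subr0 ?expr0n.
have : \sum_(n <- iota 0 N ++ s') a n ^+ 2 <= M.
  rewrite -lee_fin -aM; apply: sum_le_esum => // [n _|]; first exact: sqr_ge0.
  rewrite cat_uniq iota_uniq filter_uniq// andbT; apply/hasPn => n.
  by rewrite mem_filter mem_iota /= -leqNgt => /andP[].
by rewrite big_cat /=; lra.
Qed.

End SquareSummable.

Lemma hoffman_wielandt (R : realType) (k : scalar_kind) (H : hilbertSpace R k)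
    (A B : {linear H -> H}) (a b : nat -> R) (eps : R) :
  selfadjoint A -> selfadjoint B -> hilbert_schmidt A -> hilbert_schmidt B ->
  eigenvalue_enum A a -> eigenvalue_enum B b -> 0 < eps ->
  exists pi : nat -> nat, bijective pi /\
    (l2norm (fun n => a n - b (pi n))%R <= hs_norm (fun x => A x - B x)%R + eps%:E)%E.
Proof.
move=> Asa Bsa Ahs Bhs aE bE eps0.
have [u [uO uA]] := eigen_sequence Asa aE.
have [v [vO vB]] := eigen_sequence Bsa bE.
(* An infinite right side is trivial; splitting it off makes [r] real. *)
have [rinf|rfin] := eqVneq (hs_norm (fun x => A x - B x)) +oo%E.
  exists id; split; first exact: (Bijective (g := id)).
  by rewrite rinf addye// leey.
have {}rfin : (hs_norm (fun x => A x - B x)%R < +oo)%E by rewrite ltey.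
rewrite (hs_norm_fin rfin) -EFinD; have rE := hs2_fine rfin.
have r0 := fine_hs_norm_ge0 (fun x => A x - B x).
set r := fine _ in rE r0 *.
(* Four errors of size [d]: the two operator truncations and the two tails of the eigenvalue
   sequences. *)
pose d := eps / 4; have d0 : 0 < d by rewrite divr_gt0.
have aM := hs2_eigen Asa aE Ahs uO uA; have bM := hs2_eigen Bsa bE Bhs vO vB.
have d20 : 0 < d ^+ 2 by rewrite exprn_gt0.
have AM := hs2_fine Ahs.2; have BM := hs2_fine Bhs.2.
have [Na aN] := square_sum_tail (etrans (esym aM) AM) d20.
have [Nb bN] := square_sum_tail (etrans (esym bM) BM) d20.
pose N := maxn Na Nb.
have [aN1 aN2] := aN N (leq_maxl _ _); have [bN1 bN2] := bN N (leq_maxr _ _).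
have uinj : injective u.
  move=> i j uij; apply/eqP; have := uO i j I I.
  by rewrite uij uO// eqxx; case: (i == j) => // /eqP; rewrite oner_eq0.
pose f := map u (iota 0 N).
have uf : uniq f by rewrite map_inj_uniq// iota_uniq.
have fO : orthonormal_on [set` f] id.
  move=> _ _ /mapP[i _ ->] /mapP[j _ ->].
  by rewrite uO// (inj_eq uinj).
have [g [uF FO Fspan]] := orthonormal_completion (map v (iota 0 N)) uf fO.
have Fv n : (n < N)%N -> rnorm (v n) ^+ 2 <= \sum_(e <- f ++ g) sqip (v n) e.
  by move=> nN; apply: Fspan; rewrite map_f// mem_iota.
have Fu n : (n < N)%N -> rnorm (u n) ^+ 2 <= \sum_(e <- f ++ g) sqip (u n) e.
  move=> nN; have un : u n \in f ++ g by rewrite mem_cat map_f// mem_iota.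
  rewrite (bigD1_seq (u n))//= /sqip ipxx sabs_ofreal real_normK ?num_real//.
  rewrite (rnorm_orthonormal uO)// !expr1n lerDl sumr_ge0// => i _.
  exact: sqr_ge0.
pose p (i j : 'I_N) := sqip (u i) (v j).
have [|i|j|s sP] := @substochastic_assignment R N p (fun i => a i) (fun j => b j).
- by move=> i j; exact: sqip_ge0.
- rewrite /p -(sum_iota _ (fun j => sqip (u i) (v j))).
  apply: le_trans (bessel vO (iota_uniq _ _) (fun _ _ => I) (u i)) _.
  by rewrite (rnorm_orthonormal uO)// expr1n.
- rewrite /p -(sum_iota _ (fun i => sqip (u i) (v j))).
  under eq_bigr do rewrite sqipC.
  apply: le_trans (bessel uO (iota_uniq _ _) (fun _ _ => I) (v j)) _.
  by rewrite (rnorm_orthonormal vO)// expr1n.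
have padE (c : nat -> R) i : zero_pad (fun i : 'I_N => c i) i = head_seq c N i.
  rewrite /zero_pad /head_seq; case: fintype.splitP => [j E|j _ //].
  exact: congr1 (esym E).
pose pi n := if insub n is Some i then val (s i) else n.
pose pi' n := if insub n is Some i then val ((s^-1)%g i) else n.
have piP : cancel pi pi'.
  move=> n; rewrite /pi /pi'; case: (@insubP _ _ 'I_(N + N) n) => [i _ <-|nN].
    by rewrite valK permK.
  by rewrite insubN.
have piP' : cancel pi' pi.
  move=> n; rewrite /pi /pi'; case: (@insubP _ _ 'I_(N + N) n) => [i _ <-|nN].
    by rewrite valK permKV.
  by rewrite insubN.
exists pi; split; first exact: (Bijective piP piP').
have gap : l2s (f ++ g) (fun e => rnorm (truncation A u N e - truncation B v N e))
    <= r + 2 * d.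
  apply: (@le_trans _ _ (l2s (f ++ g) (fun e => rnorm (A e - B e) +
      (rnorm (A e - truncation A u N e) + rnorm (B e - truncation B v N e))))).
    apply: l2s_mono => e; rewrite rnorm_ge0 /=.
    have -> : truncation A u N e - truncation B v N e = (A e - B e) +
       (- (A e - truncation A u N e) + (B e - truncation B v N e)).
      by rewrite opprB addrCA [X in _ = _ + X]addrA subrK addrA subrK.
    apply: le_trans (ler_rnormD _ _) _; rewrite lerD2l.
    by apply: le_trans (ler_rnormD _ _) _; rewrite rnormN.
  apply: le_trans (minkowski_sum _ _ _) _; apply: lerD.
    rewrite -(@ler_pXn2r _ 2) ?nnegrE ?l2s_ge0// sqr_l2s -lee_fin -rE.
    apply: (@hs2_orthonormal _ _ _ _ _ _ (A \- B : {linear H -> H})) FO _ uF _ => //.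
    by move=> x y /=; rewrite ipBl ipBr Asa Bsa.
  apply: le_trans (minkowski_sum _ _ _) _.
  rewrite mulr_natl mulr2n; apply: lerD;
    rewrite -(@ler_pXn2r _ 2) ?nnegrE ?l2s_ge0 ?(ltW d0)// sqr_l2s.
    by apply: le_trans aN1; exact: truncation_error.
  by apply: le_trans bN1; exact: truncation_error.
have assign : \sum_(i < N + N) (head_seq a N i - head_seq b N (s i)) ^+ 2
    <= (r + 2 * d) ^+ 2.
  have hsum (c : nat -> R) : \sum_(i < N + N) head_seq c N i ^+ 2 =
      \sum_(i <- iota 0 N) c i ^+ 2.
    rewrite big_split_ord /= [X in _ + X]big1 ?addr0.
      by rewrite sum_iota; apply: eq_bigr => i _; rewrite /head_seq ltn_ord.
    by move=> i _; rewrite /head_seq ltnNge leq_addr /= expr0n.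
  apply: (@le_trans _ _ (\sum_(e <- f ++ g)
      rnorm (truncation A u N e - truncation B v N e) ^+ 2)); last first.
    rewrite -sqr_l2s ler_pXn2r ?nnegrE ?l2s_ge0//.
    by rewrite addr_ge0// mulr_ge0// ltW.
  apply: le_trans (truncation_gap Asa Bsa uO vO uA vB uF FO Fv).
  have -> : \sum_(i < N + N) (head_seq a N i - head_seq b N (s i)) ^+ 2 =
      \sum_(i < N + N) head_seq a N i ^+ 2 + \sum_(i < N + N) head_seq b N i ^+ 2
      - 2 * \sum_(i < N + N) head_seq a N i * head_seq b N (s i).
    rewrite [X in _ + X - _](reindex_inj (@perm_inj _ s)) mulr_sumr -big_split /=.
    by rewrite -sumrB; apply: eq_bigr => i _; rewrite sqrrB -mulr_natl; ring.
  rewrite !hsum lerB// ler_pM2l//.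
  move: sP; under [X in _ <= X -> _]eq_bigr do rewrite !padE.
  apply: le_trans; rewrite le_eqVlt; apply/orP; left; apply/eqP.
  by rewrite sum_iota; apply: eq_bigr => i _; rewrite sum_iota.
have c0 : 0 <= r + eps by rewrite addr_ge0// ltW.
apply: l2norm_le => // t ut.
have -> : r + eps = d + ((r + 2 * d) + d) by rewrite /d; lra.
apply: (@le_trans _ _ (l2s t (fun n => (a n - head_seq a N n) +
   ((head_seq a N n - head_seq b N (pi n)) + (head_seq b N (pi n) - b (pi n)))))).
  rewrite le_eqVlt; apply/orP; left; apply/eqP; congr Num.sqrt.
  by apply: eq_bigr => n _; congr (_ ^+ 2); ring.
have rd0 : 0 <= r + 2 * d by rewrite addr_ge0// mulr_ge0// ltW.
apply: le_trans (minkowski_sum _ _ _) _; apply: lerD.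
  by rewrite -(@ler_pXn2r _ 2) ?nnegrE ?l2s_ge0 ?(ltW d0)// sqr_l2s aN2.
apply: le_trans (minkowski_sum _ _ _) _; apply: lerD; last first.
  rewrite -(@ler_pXn2r _ 2) ?nnegrE ?l2s_ge0 ?(ltW d0)// sqr_l2s.
  have := bN2 (map pi t); rewrite big_map map_inj_uniq; last exact: can_inj piP.
  move=> /(_ ut); apply: le_trans.
  by rewrite le_eqVlt; apply/orP; left; apply/eqP; apply: eq_bigr => n _; ring.
rewrite -(@ler_pXn2r _ 2) ?nnegrE ?l2s_ge0// sqr_l2s; apply: le_trans assign.
pose h n := (head_seq a N n - head_seq b N (pi n)) ^+ 2.
have hE (i : 'I_(N + N)) : h i = (head_seq a N i - head_seq b N (s i)) ^+ 2.
  by rewrite /h /pi valK.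
under [leRHS]eq_bigr do rewrite -hE.
rewrite -(sum_iota _ h).
(* From [2 N] on [pi] is the identity and both heads vanish. *)
rewrite (bigID (fun n => n < N + N)%N) /= [X in _ + X]big1 ?addr0; last first.
  move=> n nN; rewrite /pi insubN// /head_seq.
  have -> : (n < N)%N = false.
    by apply/negbTE; apply: contra nN => /leq_trans; apply; exact: leq_addr.
  by rewrite subrr expr0n.
rewrite -big_filter; apply: sum_uniq_sub_le => [n|||n].
- exact: sqr_ge0.
- exact: filter_uniq.
- exact: iota_uniq.
- by rewrite mem_filter mem_iota => /andP[].
Qed.

(** * Generalized numbers and idempotents *)

Section GeneralizedNumbers.
Variable R : realType.
Implicit Types (u v : I01 R -> R) (x y : mnet R).
Local Notation class := (\pi_(gennum R)%qT).

Lemma class_eqP x y : class x = class y <-> null (EFin \o (fun eps => x eps - y eps)).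
Proof.
split => [|h].
  by move=> /eqP; rewrite -Quotient.idealrBE => /asboolP.
by apply/eqP; rewrite -Quotient.idealrBE; apply/asboolP.
Qed.

Lemma moderate_dominated u v : (forall eps, `|v eps| <= u eps) ->
  moderate (EFin \o u) -> moderate (EFin \o v).
Proof.
move=> vu [n un]; exists n; apply: filterS un => eps /=; rewrite !lee_fin.
by apply: le_trans; apply: le_trans (vu eps) (ler_norm _).
Qed.

Lemma moderate_cst (c : R) : moderate (EFin \o (fun=> c) : I01 R -> \bar R).
Proof.
apply/moderateP; exists 1%N.
have c0 : 0 < (`|c| + 1)^-1 by rewrite invr_gt0 ltr_wpDl.
apply: filterS (small_lt c0) => eps h; rewrite expr1.
have e0 := I01_gt0 eps.
rewrite -(@ler_pM2r _ (val eps))// mulVf ?gt_eqF//.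
have h1 : (`|c| + 1) * val eps <= 1.
  rewrite -[leRHS](@divff _ (`|c| + 1)) ?gt_eqF ?ltr_wpDl//.
  by rewrite ler_pM2l ?ltr_wpDl// ltW.
by apply: le_trans h1; rewrite ler_wpM2r ?(ltW e0)// lerDl.
Qed.

Lemma mem_moderateD u v : moderate (EFin \o u) -> moderate (EFin \o v) ->
  moderate (EFin \o (fun eps => u eps + v eps)).
Proof.
move=> um vm.
have um' : u \in @moderate_pred R by apply/asboolP.
have vm' : v \in @moderate_pred R by apply/asboolP.
exact: (asboolW (rpredD um' vm')).
Qed.

Lemma mnet_moderate x : moderate (EFin \o x).
Proof. exact: asboolW (valP x). Qed.

Lemma mnet_exists u : moderate (EFin \o u) -> exists x, mnet_val x = u.
Proof.
move=> um; have um' : u \in @moderate_pred R by apply/asboolP.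
by exists (MNet um').
Qed.

Lemma gclass_intro x (U : I01 R -> \bar R) : (forall eps, U eps = (x eps)%:E) ->
  gclass U (class x).
Proof. by move=> UE; exists x; split => //; apply: nearW. Qed.

Lemma null_small u : null (EFin \o u) ->
  forall d : R, 0 < d -> \forall eps \near @small R, `|u eps| <= d.
Proof.
move=> /nullP/(_ 1%N) u1 d d0; near=> eps.
apply: (@le_trans _ _ (val eps)); first by near: eps; apply: filterS u1 => eps; rewrite expr1.
by apply: ltW; near: eps; exact: small_lt.
Unshelve. all: by end_near. Qed.

Lemma class_grepr (e : gennum R) : class (repr e) = e.
Proof. exact: reprK. Qed.

(** The chosen representatives of [class x] and of 0 differ from [x] and 0 by null nets; each of the
    three terms gets a third of [d]. *)
Lemma gapprox_class0 x :
  (forall d : R, 0 < d -> \forall eps \near @small R, `|x eps| <= d) ->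
  gapprox (class x) 0.
Proof.
move=> x0; rewrite /gapprox; apply: (cvgr0Pnorm_le _).2 => d d0.
have n1 := (class_eqP (repr (class x)) x).1 (reprK _).
have n0 := (class_eqP (repr (0 : gennum R)) 0).1 (etrans (reprK _) (esym (rmorph0 _))).
have d3 : 0 < d / 3 by rewrite divr_gt0.
near=> eps.
have h1 : `|grepr (class x) eps - x eps| <= d / 3 by near: eps; exact: null_small n1 _ d3.
have h0 : `|grepr (0 : gennum R) eps - 0| <= d / 3 by near: eps; exact: null_small n0 _ d3.
have hx : `|x eps| <= d / 3 by near: eps; exact: x0.
have -> : grepr (class x) eps - grepr (0 : gennum R) eps =
  (grepr (class x) eps - x eps) + x eps - (grepr (0 : gennum R) eps - 0).
  by rewrite subrK subr0.
apply: le_trans (ler_normB _ _) _; have -> : d = d / 3 + d / 3 + d / 3 by lra.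
apply: lerD h0; apply: le_trans (ler_normD _ _) _; exact: lerD.
Unshelve. all: by end_near. Qed.

Lemma moderate_norm_mnet x : exists y, forall eps, y eps = `|x eps|.
Proof.
have [|y yE] := @mnet_exists (fun eps => `|x eps|).
  have [n xn] := mnet_moderate x; exists n; apply: filterS xn => eps /=.
  by rewrite normr_id.
by exists y => eps; rewrite yE.
Qed.

Section Idempotent.
Variable e : gennum R.
Hypothesis e_idem : e = e ^+ 2.
Local Notation u := (grepr e).

Lemma idempotent_null : null (EFin \o (fun eps => u eps * u eps - u eps)).
Proof.
apply: (class_eqP (repr e * repr e) (repr e)).1.
by rewrite rmorphM /= !class_grepr -expr2 -e_idem.
Qed.

(** With [u] the representative, [|u| - u^2 = |u| (1 - |u|)] is dominated by [|u^2 - u|], which is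
    null. Needed because norms of scaled operators carry the factor [|u|]. *)
Lemma idempotent_norm x : (forall eps, x eps = `|u eps|) -> class x = e.
Proof.
move=> xE; transitivity (class (repr e * repr e)); last first.
  by rewrite rmorphM /= !class_grepr -expr2 -e_idem.
apply/class_eqP/nullP => q.
have /nullP/(_ q) := idempotent_null; apply: filterS => eps; apply: le_trans.
have -> : (repr e * repr e : mnet R) eps = u eps * u eps by [].
rewrite xE; set t := u eps.
have -> : `|t| - t * t = `|t| * (1 - `|t|).
  by rewrite mulrBr mulr1 -!expr2 real_normK ?num_real.
rewrite -[X in _ <= `|_ - X|]mulr1 -mulrBr !normrM normr_id ler_wpM2l//.
by rewrite distrC -[X in `|_ - X|]normr1; exact: ler_dist_dist.
Qed.

Lemma idempotent_le2 : \forall eps \near @small R, `|u eps| <= 2.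
Proof.
apply: filterS (null_small idempotent_null ltr01) => eps h; rewrite leNgt; apply/negP => u2.
have : 1 < `|u eps| - 1 by lra.
move: h; rewrite -[X in _ - X]mulr1 -mulrBr normrM => h h1.
have h2 : `|u eps| - 1 <= `|u eps - 1|.
  by apply: le_trans (lerB_dist _ _); rewrite normr1.
have : 1 * 1 < `|u eps| * `|u eps - 1|.
  by apply: ltr_pM => //; [lra|exact: lt_le_trans h2].
by rewrite mulr1 ltNge h.
Qed.

(** Where [|u| < 1/2], the factor [|u - 1|] exceeds [1/2], so [|u| <= 2 |u^2 - u|]. If this held for
    all small eps satisfying [P], then [u] would be null. *)
Lemma idempotent_frequently (P : I01 R -> Prop) : e != 0 ->
  (\forall eps \near @small R, P eps) -> exists eps, P eps /\ 2^-1 <= `|u eps|.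
Proof.
move=> e0 nP; apply: contrapT => /forallNP nh.
move/eqP: e0; apply; rewrite -(class_grepr e) -[RHS](rmorph0 class).
apply/class_eqP/nullP => q.
(* The extra power of eps absorbs the factor 2. *)
have /nullP/(_ q.+1) h := idempotent_null.
have h2 : 0 < (2^-1 : R) by rewrite invr_gt0.
near=> eps.
have Pe : P eps by near: eps.
have ue : `|u eps| < 2^-1 by rewrite ltNge; apply/negP => he; apply: (nh eps).
have : `|u eps * u eps - u eps| <= val eps ^+ q.+1 by near: eps.
have e2 : val eps < 2^-1 by near: eps; exact: small_lt.
rewrite -[X in _ - X]mulr1 -mulrBr normrM exprS => h1.
have -> : (repr e : mnet R) eps - (0 : mnet R) eps = u eps by rewrite subr0.
have hu : 2^-1 <= `|u eps - 1|.
  by rewrite distrC; have := lerB_dist 1 (u eps); rewrite normr1; lra.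
have hq : 0 <= val eps ^+ q by rewrite exprn_ge0// ltW// I01_gt0.
have h3 : `|u eps| * 2^-1 <= val eps * val eps ^+ q.
  by apply: le_trans h1; rewrite ler_wpM2l.
have h4 : val eps * val eps ^+ q <= 2^-1 * val eps ^+ q by rewrite ler_wpM2r// ltW.
by lra.
Unshelve. all: by end_near. Qed.

(** The representative differs from the indicator by a null net. This lets the factor [e] be divided
    out along [S]. *)
Lemma idempotent_support (S : set (I01 R)) : gclass (fun eps => (\1_S eps)%:E) e ->
  \forall eps \near @small R, S eps -> 2^-1 <= `|u eps|.
Proof.
move=> [v [ev Sv]].
have uv := (class_eqP (repr e) v).1 (etrans (class_grepr e) ev).
have h2 : 0 < (2^-1 : R) by rewrite invr_gt0.
near=> eps => Se.
have h : `|u eps - v eps| <= 2^-1 by near: eps; exact: null_small uv _ h2.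
have vE : (\1_S eps)%:E = (v eps)%:E by near: eps.
move: vE h; rewrite indicE mem_set// => -[<-] h.
have := lerB_dist 1 (u eps); rewrite normr1 distrC => h1.
by lra.
Unshelve. all: by end_near. Qed.

End Idempotent.

End GeneralizedNumbers.

(** * The limit operator *)

Section OperatorNets.
Variables (R : realType) (k : scalar_kind) (H : hilbertSpace R k).
Local Notation ip := (inner H).
Variables (T : I01 R -> {linear H -> H}) (T0 : {linear H -> H}) (e : gennum R).
Hypotheses (e_idem : e = e ^+ 2) (e_neq0 : e != 0) (eT : op_approx e T T0)
  (Tsa : forall eps, selfadjoint (T eps)) (Ths : forall eps, hilbert_schmidt (T eps))
  (T0bd : bounded_operator T0).
Local Notation diff eps := (fun x : H => (T eps x - T0 x)%R).

Lemma hs_norm_scaled_diff eps :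
  hs_norm (scaled_diff e T T0 eps) = (`|grepr e eps|%:E * hs_norm (diff eps))%E.
Proof. exact: hs_norm_scale. Qed.

Lemma scaled_diff_small (d : R) : 0 < d ->
  \forall eps \near @small R, (`|grepr e eps|%:E * hs_norm (diff eps) <= d%:E)%E.
Proof.
move=> d0; have /fine_cvgP[fin /cvgr0Pnorm_le/(_ _ d0) le] := eT.
near=> eps; rewrite -hs_norm_scaled_diff.
have F : hs_norm (scaled_diff e T T0 eps) \is a fin_num by near: eps.
have L : `|fine (hs_norm (scaled_diff e T T0 eps))| <= d by near: eps.
by rewrite -(fineK F) lee_fin; apply: le_trans L; exact: ler_norm.
Unshelve. all: by end_near. Qed.

(** At some eps the factor [|e_eps|] is at least [1/2] and can be divided out. One such eps for each
    [d] is enough to pass properties on to [T0]. *)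
Lemma diff_small (d : R) : 0 < d -> exists eps,
  (hs_norm (diff eps) <= d%:E)%E.
Proof.
move=> d0; have d20 : 0 < d / 2 by rewrite divr_gt0.
have [eps [h u2]] := idempotent_frequently e_idem e_neq0 (scaled_diff_small d20).
exists eps; have : (2^-1%:E * hs_norm (diff eps) <= (d / 2)%:E)%E.
  by apply: le_trans h; rewrite lee_wpmul2r ?hs_norm_ge0 ?lee_fin.
by rewrite EFinM muleC lee_pmul2r ?lte_fin ?invr_gt0.
Qed.

Lemma limit_hilbert_schmidt : hilbert_schmidt T0.
Proof.
split => //; have [eps h] := diff_small ltr01.
rewrite hs_norm_lty.
have -> : hs2 T0 = hs2 (fun x => T eps x - (T eps x - T0 x))%R.
  by apply: eq_esum => b _; rewrite opprB addrC subrK.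
apply: le_lt_trans (hs2_sub _ _) _.
have h1 : (hs2 (T eps) < +oo)%E by rewrite -hs_norm_lty; exact: (Ths eps).2.
have h2 : (hs2 (diff eps) < +oo)%E.
  by rewrite -hs_norm_lty; apply: le_lt_trans h _; rewrite ltry.
by rewrite !lte_add_pinfty.
Qed.

Lemma diff_bounded eps : bounded_operator (T eps \- T0).
Proof.
have [M M0 TM] := bounded_rnorm (Ths eps).1; have [N N0 T0N] := bounded_rnorm T0bd.
exists (ofreal k (M + N)) => x; rewrite -!ofreal_rnorm -rmorphM /= ler_ofreal.
by rewrite mulrDl; apply: le_trans (ler_rnormD _ _) _; rewrite rnormN lerD.
Qed.

Lemma limit_selfadjoint : selfadjoint T0.
Proof.
move=> x y; apply/eqP; rewrite -subr_eq0 -sabs_eq0 eq_le sabs_ge0 andbT.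
apply: ler0_small => d d0; pose c := 2 * (rnorm x * rnorm y) + 1.
have c0 : 0 < c by rewrite ltr_wpDl// !mulr_ge0 ?rnorm_ge0.
have [eps h] := diff_small (divr_gt0 d0 c0).
have hfin : (hs_norm (diff eps) < +oo)%E by apply: le_lt_trans h _; rewrite ltry.
have rD z : rnorm (T eps z - T0 z) <= d / c * rnorm z.
  have := @rnorm_le_hs_norm _ _ _ (T eps \- T0) z (diff_bounded eps) hfin.
  move=> /le_trans; apply; rewrite ler_wpM2r ?rnorm_ge0//.
  by rewrite -lee_fin -(hs_norm_fin hfin).
(* The terms in [T eps] cancel by selfadjointness, leaving two errors of at most [d / c * |x| |y|],
   hence the 2 in [c]. *)
have -> : ip (T0 x) y - ip x (T0 y) =
    ip x (T eps y - T0 y) + ip (T0 x - T eps x) y.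
  by rewrite ipBl ipBr Tsa [RHS]addrC addrA subrK.
apply: le_trans (sabsD _ _) _.
apply: (@le_trans _ _ (d / c * rnorm y * rnorm x + d / c * rnorm x * rnorm y)).
  apply: lerD; apply: le_trans (sabs_ip_le _ _) _.
    by rewrite mulrC ler_wpM2r ?rnorm_ge0.
  by rewrite rnorm_distC ler_wpM2r ?rnorm_ge0.
rewrite (_ : _ + _ = d / c * (c - 1)); last by rewrite /c; ring.
rewrite mulrBr mulr1 divfK ?gt_eqF// lerBlDr lerDl.
by rewrite divr_ge0 ?ltW.
Qed.

Lemma diff_fin eps : (hs_norm (diff eps) < +oo)%E.
Proof.
rewrite hs_norm_lty; apply: le_lt_trans (hs2_sub _ _) _.
by rewrite !lte_add_pinfty// -hs_norm_lty ?(Ths eps).2// limit_hilbert_schmidt.2.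
Qed.

(** The net is bounded by [2 (|T_eps| + |T0|)], a sum of moderate nets. *)
Lemma diff_moderate : moderate (fun eps => hs_norm (T eps)) ->
  moderate (EFin \o (fun eps => fine (hs_norm (diff eps)))).
Proof.
move=> Tmod.
have Tm : moderate (EFin \o (fun eps => fine (hs_norm (T eps)))).
  have [n Tn] := Tmod; exists n; apply: filterS Tn => eps.
  by rewrite {1}(hs_norm_fin (Ths eps).2).
have h0 := limit_hilbert_schmidt.2.
have bm := mem_moderateD (mem_moderateD Tm (moderate_cst (fine (hs_norm T0))))
  (mem_moderateD Tm (moderate_cst (fine (hs_norm T0)))).
apply: moderate_dominated bm => eps.
rewrite ger0_norm ?fine_hs_norm_ge0//.
set a := fine (hs_norm (T eps)); set b := fine (hs_norm T0).
have a0 : 0 <= a := fine_hs_norm_ge0 _; have b0 : 0 <= b := fine_hs_norm_ge0 _.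
rewrite -(@ler_pXn2r _ 2) ?nnegrE ?fine_hs_norm_ge0 ?addr_ge0//.
have := hs2_sub (T eps) T0; rewrite (hs2_fine (diff_fin eps)).
rewrite (hs2_fine (Ths eps).2) (hs2_fine h0) -!EFinD lee_fin.
rewrite -/a -/b => /le_trans; apply.
rewrite -subr_ge0.
have -> : (a + b + (a + b)) ^+ 2 - (a ^+ 2 + a ^+ 2 + (b ^+ 2 + b ^+ 2)) =
  2 * a ^+ 2 + 2 * b ^+ 2 + 8 * (a * b) by ring.
by rewrite !addr_ge0// mulr_ge0// ?sqr_ge0// mulr_ge0.
Qed.

End OperatorNets.

(** * The permutation net and the passage to generalized numbers *)

Theorem corollary5p14 (R : realType) (k : scalar_kind) (H : hilbertSpace R k)
    (Hinf : infinite_dimensional H)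
    (T : I01 R -> {linear H -> H})
    (Tsa : forall eps : I01 R, selfadjoint (T eps))
    (Ths : forall eps : I01 R, hilbert_schmidt (T eps))
    (Tmod : moderate (fun eps : I01 R => hs_norm (T eps)))
    (T0 : {linear H -> H}) (T0supp : supp T T0)
    (e : gennum R) (e_idem : e = e ^+ 2) (e_neq0 : e != 0)
    (eT : op_approx e T T0)
    (t : I01 R -> nat -> R)
    (tE : forall eps : I01 R, eigenvalue_enum (T eps) (t eps))
    (t0 : nat -> R) (t0E : eigenvalue_enum T0 t0) :
  exists pi : I01 R -> nat -> nat,
    [/\ forall eps : I01 R, bijective (pi eps),
        (exists d D : gennum R,
          [/\ gclass (fun eps : I01 R =>
                l2norm (fun n => t0 n - t eps (pi eps n))) d,
              gclass (fun eps : I01 R => hs_norm (scaled_diff e T T0 eps)) D,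
              gle (e * d) (D + e * alpha R) &
              gapprox (D + e * alpha R) 0]),
        l2_moderate t &
        (* t^pi converges to t0 in l_2 along the support of e *)
        forall S : set (I01 R), gclass (fun eps : I01 R => (\1_S eps)%:E) e ->
          l2norm (fun n => t eps (pi eps n) - t0 n)
            @[eps --> within S (@small R)] --> 0%E].
Proof.
have T0bd := T0supp.1.
have T0hs := limit_hilbert_schmidt e_idem e_neq0 eT Ths T0bd.
have T0sa := limit_selfadjoint e_idem e_neq0 eT Tsa Ths T0bd.
have Dfin := diff_fin e_idem e_neq0 eT Ths T0bd.
have Dmod := diff_moderate e_idem e_neq0 eT Ths T0bd Tmod.
pose h eps := fine (hs_norm (fun x => T eps x - T0 x)).
have hE eps : hs_norm (fun x => T eps x - T0 x)%R = (h eps)%:E := hs_norm_fin (Dfin eps).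
have h0 eps : 0 <= h eps := fine_hs_norm_ge0 _.
have diffC eps : hs_norm (fun x => T0 x - T eps x)%R = (h eps)%:E.
  rewrite -hE; congr sqrte; apply: eq_esum => b _; by rewrite rnorm_distC.
have /choice[pi piP] eps : exists p : nat -> nat, bijective p /\
    (l2norm (fun n => t0 n - t eps (p n))%R <= (h eps + val eps)%:E)%E.
  have [p [pb pl]] := hoffman_wielandt T0sa (Tsa eps) T0hs (Ths eps) t0E (tE eps) (I01_gt0 eps).
  by exists p; split => //; rewrite EFinD -diffC.
pose dd eps := fine (l2norm (fun n => t0 n - t eps (pi eps n))).
have ddge eps : (0 <= l2norm (fun n => t0 n - t eps (pi eps n))%R)%E by exact: sqrte_ge0.
have ddE eps : l2norm (fun n => t0 n - t eps (pi eps n))%R = (dd eps)%:E.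
  rewrite /dd fineK// ge0_fin_numE//.
  by apply: le_lt_trans (piP eps).2 _; rewrite ltry.
have dd0 eps : 0 <= dd eps by rewrite -lee_fin -ddE.
have ddh eps : dd eps <= h eps + val eps by rewrite -lee_fin -ddE (piP eps).2.
have [mh mhE] := mnet_exists Dmod.
pose ma := MNet (alpha_subproof R).
have [md mdE] : exists md : mnet R, mnet_val md = dd.
  apply: mnet_exists.
  apply: (moderate_dominated _ (mem_moderateD Dmod (mnet_moderate ma))) => eps.
  by rewrite ger0_norm ?dd0// ddh.
have [mu muE] := moderate_norm_mnet (repr e).
have muP : \pi_(gennum R)%qT mu = e := idempotent_norm e_idem muE.
pose ru : mnet R := repr e.
have ruP : \pi_(gennum R)%qT ru = e := class_grepr e.
have small_scaled d : 0 < d -> \forall eps \near @small R, `|grepr e eps| * h eps <= d.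
  move=> d_gt0; apply: filterS (scaled_diff_small eT d_gt0) => eps.
  by rewrite hE lee_fin.
exists pi; split.
- by move=> eps; exact: (piP eps).1.
- exists (\pi_(gennum R)%qT md), (\pi_(gennum R)%qT (mu * mh)); split.
  + by apply: gclass_intro => eps; rewrite ddE mdE.
  + apply: gclass_intro => eps; rewrite hs_norm_scaled_diff hE -EFinM.
    by rewrite (_ : (mu * mh) eps = mu eps * mh eps)// muE mhE.
  (* The representative [ru * ru] of [e = e^2] is nonnegative at every eps, so the inequality
     between real nets may be multiplied by it. *)
  + exists (ru * ru * md), (ru * ru * mh + ru * ru * ma); split.
    * by rewrite !rmorphM /= ruP -expr2 -e_idem.
    * by rewrite rmorphD !rmorphM /= muP ruP -expr2 -e_idem.
    apply: nearW => eps.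
    rewrite (_ : (ru * ru * md) eps = ru eps * ru eps * dd eps); last by rewrite -mdE.
    rewrite (_ : (ru * ru * mh + ru * ru * ma) eps = ru eps * ru eps * h eps +
      ru eps * ru eps * val eps); last by rewrite -[h]mhE.
    by rewrite -mulrDr ler_wpM2l// -expr2 sqr_ge0.
  + have -> : \pi_(gennum R)%qT (mu * mh) + e * alpha R =
        \pi_(gennum R)%qT (mu * mh + mu * ma).
      by rewrite rmorphD !rmorphM /= muP.
    apply: gapprox_class0 => d d0; have d20 : 0 < d / 2 by rewrite divr_gt0.
    have d40 : 0 < d / 4 by rewrite divr_gt0.
    near=> eps.
    have -> : (mu * mh + mu * ma) eps =
       `|grepr e eps| * h eps + `|grepr e eps| * val eps.
      by rewrite -muE -[h]mhE.
    have e0 : 0 <= val eps := ltW (I01_gt0 eps).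
    rewrite ger0_norm; last by rewrite addr_ge0// mulr_ge0.
    have a1 : `|grepr e eps| * h eps <= d / 2 by near: eps; exact: small_scaled.
    have a2 : `|grepr e eps| <= 2 by near: eps; exact: idempotent_le2.
    have a3 : val eps <= d / 4.
      by apply: ltW; near: eps; exact: small_lt.
    have : `|grepr e eps| * val eps <= 2 * (d / 4) by rewrite ler_pM.
    by lra.
- split=> [eps|].
    by rewrite (l2norm_eigen (Tsa eps) (Ths eps) (tE eps)) (Ths eps).2.
  have [n Tn] := Tmod; exists n; apply: filterS Tn => eps.
  by rewrite (l2norm_eigen (Tsa eps) (Ths eps) (tE eps)).
- move=> S Se; have Su := idempotent_support Se.
  have l2C eps : l2norm (fun n => t eps (pi eps n) - t0 n) = (dd eps)%:E.
    rewrite -ddE /l2norm; congr sqrte; apply: eq_eseriesr => n _.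
    by rewrite distrC.
  under eq_cvg do rewrite l2C.
  apply: cvg_EFin; first exact: nearW.
  apply/cvgr0Pnorm_le => d d0; rewrite near_withinE.
  have d40 : 0 < d / 4 by rewrite divr_gt0.
  have d20 : 0 < d / 2 by rewrite divr_gt0.
  near=> eps => eS /=.
  rewrite ger0_norm ?dd0//; apply: (le_trans (ddh eps)).
  (* Dividing by [|e_eps| >= 1/2] on [S] turns [d / 4] into [h eps <= d / 2]. *)
  have a1 : `|grepr e eps| * h eps <= d / 4 by near: eps; exact: small_scaled.
  have a2 : 2^-1 <= `|grepr e eps| by move: eS; near: eps.
  have a3 : val eps <= d / 2 by apply: ltW; near: eps; exact: small_lt.
  have : 2^-1 * h eps <= `|grepr e eps| * h eps by rewrite ler_wpM2r.
  by lra.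
Unshelve. all: by end_near. Qed.
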